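(* Let $t,s$ be nonnegative integers and let $m\ge 2$ be an integer. Suppose that one of the following holds. (i) The pairs $(A_i,B_i)$, $1\le i\le m$, are pairs of finite sets satisfying $|A_i\cap B_i|\le t$ for all $i$ and $|A_i\cap B_j|>t+s$ for all $i\ne j$; put $a_i=|A_i|$ and $b_i=|B_i|$. (ii) The pairs $(A_i,B_i)$, $1\le i\le m$, are pairs of subspaces of a finite-dimensional vector space over an arbitrary field satisfying $\dim(A_i\cap B_i)\le t$ for all $i$ and $\dim(A_i\cap B_j)>t+s$ for all $i\ne j$; put $a_i=\dim A_i$ and $b_i=\dim B_i$. Then, in either case, $$\sum_{i=1}^{m}\frac{1}{\binom{a_i+b_i-2t}{a_i-t}}\le\frac{2}{\binom{2s+2}{s+1}}.\qquad( * )$$ The constant on the right-hand side is best possible for all nonnegative integers $t$ and $s$: for given $t,s$, it cannot be replaced by any smaller constant valid for all such families. Moreover, for $s\ge 1$, equality holds in $( * )$ if and only if $m=2$, $a_1=b_1=a_2=b_2=t+s+1$, and $(A_2,B_2)=(B_1,A_1)$.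
   Context: Here $\binom{a}{b}$ denotes the usual binomial coefficient. The cross-intersection conditions with $m\ge2$ force $a_i,b_i\ge t+s+1$. *)

(* Defs.v *)
From HB Require Import structures.
From mathcomp Require Import all_boot all_order all_algebra.
From mathcomp Require Import finmap.

Set Implicit Arguments.
Unset Strict Implicit.
Unset Printing Implicit Defensive.

Import Order.TTheory GRing.Theory Num.Theory.
Local Open Scope ring_scope.

(* Truncation of the natural subtractions never matters: for m >= 2 the       *)
(* cross-intersection conditions force a i, b i >= t + s + 1.                  *)
Definition bollobas_sum (R : realFieldType) (t m : nat) (a b : 'I_m -> nat) : R :=
  \sum_(i < m) ('C(a i + b i - 2 * t, a i - t)%:R)^-1.

Definition bollobas_bound (R : realFieldType) (s : nat) : R :=
  2%:R / 'C(2 * s + 2, s + 1)%:R.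

Definition cross_sets (K : choiceType) (t s m : nat)
    (A B : 'I_m -> {fset K}) : Prop :=
  (forall i, #|` (A i `&` B i)%fset| <= t)%N /\
  (forall i j, i != j -> #|` (A i `&` B j)%fset| > t + s)%N.

Definition cross_subspaces (F : fieldType) (V : vectType F) (t s m : nat)
    (A B : 'I_m -> {vspace V}) : Prop :=
  (forall i, \dim (A i :&: B i) <= t)%N /\
  (forall i j, i != j -> \dim (A i :&: B j) > t + s)%N.

(* The pairs numbered 1 and 2 in mathematical notation; 'I_m starts at 0.      *)
Definition idx1 (m : nat) (hm : (1 < m)%N) : 'I_m := Ordinal (ltnW hm).
Definition idx2 (m : nat) (hm : (1 < m)%N) : 'I_m := Ordinal hm.

(* S is {fset K} or {vspace V}, and siz is cardinality or dimension.           *)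
Definition extremal_pairs (S : Type) (siz : S -> nat) (t s m : nat)
    (hm : (1 < m)%N) (A B : 'I_m -> S) : Prop :=
  [/\ m = 2%N,
      [/\ siz (A (idx1 hm)) = (t + s + 1)%N, siz (B (idx1 hm)) = (t + s + 1)%N,
          siz (A (idx2 hm)) = (t + s + 1)%N & siz (B (idx2 hm)) = (t + s + 1)%N] &
      (A (idx2 hm), B (idx2 hm)) = (B (idx1 hm), A (idx1 hm))].

(* Main.v *)
(* Over an infinite field, let (A_i, B_i) be pairs of subspaces of an N-dimensional space
   V with A_i cap B_i = 0 and A_i cap B_j <> 0 for i <> j, and put a_i = dim A_i,
   b_i = dim B_i.  For sets, one shows sum_i 1 / C(a_i + b_i, a_i) <= 1 with a random
   maximal chain: the events "some member of the chain contains A_i and avoids B_i" are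
   disjoint.  Call i good at X if A_i is contained in X and X avoids B_i.  The members that
   contain some A_i but at which no i is good form an up-set, and a chain that leaves
   the good sets of i enters it.  In the exterior algebra, the role of the sets
   containing some A_i is played by the ideal I generated by the products of the A_i,
   and that of the up-set by the ideal J of the elements of I killed by the products of all
   the B_i.  Then I / J is the direct sum of the shifted exterior algebras of the
   quotients V / (A_i + B_i), and what replaces the count of covering relations is
     (N - k) dim I_k <= (k + 1) dim J_{k+1}
        + the number of covering relations between good sets at the levels k and k + 1,
   which is proved by induction on N, splitting I and J along a generic vector.  Dividing
   by (N - k) C(N, k) and summing over k gives the inequality.

   A gap s is handled by moving s basis vectors of B_i to A_i in all possible ways, which
   gives sum_i C(a_i + s, s) / C(a_i + b_i, a_i) <= 1; a threshold t by intersecting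
   with t generic hyperplanes; finite fields by extending scalars to a field of rational
   functions; sets by coordinate subspaces.  As a_i - t >= s + 1, each numerator is at
   least C(2s + 1, s) = C(2s + 2, s + 1) / 2. *)
Require Import Defs.
From HB Require Import structures.
From mathcomp Require Import all_boot all_order all_algebra.
From mathcomp Require Import finmap.
From mathcomp Require Import zify ring lra.

Set Implicit Arguments.
Unset Strict Implicit.
Unset Printing Implicit Defensive.

Import Order.TTheory GRing.Theory Num.Theory.
Local Open Scope ring_scope.

(** * The level inequality *)

(** Rank-nullity, once per map: cutting by [lker (f i)] costs at most the dimension of an image
    under [f i]. *)
Lemma dimv_bigcap_lker (K : fieldType) (L L' : vectType K) (T : Type) (r : seq T)
    (f : T -> 'Hom(L, L')) (U : {vspace L}) :
  (\dim U <= \dim (U :&: \bigcap_(i <- r) lker (f i))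
             + \sum_(i <- r) \dim (f i @: U))%N.
Proof.
elim: r U => [|i r IH] U; first by rewrite !big_nil capvf addn0.
rewrite !big_cons capvA -(limg_ker_dim (f i) U).
have := IH (U :&: lker (f i))%VS.
have : (\sum_(j <- r) \dim (f j @: (U :&: lker (f i)))
        <= \sum_(j <- r) \dim (f j @: U))%N.
  by apply: leq_sum => j _; apply/dimvS/limgS/capvSl.
lia.
Qed.

(** Abstract setting: [x l] stands for multiplication by the l-th basis vector, [f i] for
    multiplication by the product of a basis of B_i, [c i] for a sign, and [X], [D i] for the graded
    spaces containing the ideals and their images under [f i]. *)
Section Stage.
Variables (K : fieldType) (L : vectType K) (x : nat -> 'End(L)) (N : nat).
Hypothesis xx : forall l p, x l (x l p) = 0.
Hypothesis xC : forall l l' p, x l (x l' p) = - x l' (x l p).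
Variable X : nat -> nat -> {vspace L}.
Hypothesis Xmul : forall n k, (n < N)%N -> (x n @: X n.+1 k <= X n k)%VS.
Hypothesis Xker : forall n k, (n < N)%N ->
  (X n.+1 k.+1 :&: lker (x n) <= X n k)%VS.
Hypothesis Xker0 : forall n, (n < N)%N -> (X n.+1 0 :&: lker (x n) = 0)%VS.
Variables (T : finType) (s a : T -> nat) (f : T -> 'End(L)) (c : T -> K).
Hypothesis c_neq0 : forall i, c i != 0.
Hypothesis fx : forall i l p, f i (x l p) = c i *: x l (f i p).
Variable D : T -> nat -> nat -> {vspace L}.
Hypothesis Ddim : forall i n k, (s i <= n < N)%N ->
  (\dim (D i n k) <= if (a i <= k)%N then 'C(n - s i, k - a i) else 0)%N.
Hypothesis Dmul : forall i n k, (s i <= n < N)%N -> (x n @: D i n.+1 k = D i n k)%VS.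
Hypothesis Dker : forall i n k, (s i <= n < N)%N ->
  (D i n.+1 k.+1 :&: lker (x n) <= D i n k)%VS.
Hypothesis Dkill : forall i k l q, (l < s i)%N -> q \in D i (s i) k -> x l q = 0.

(* The number of covering relations between levels k - a and k - a + 1 of the Boolean
   lattice of rank n - s. *)
Definition stage_edges i n k :=
  if (a i <= k)%N then ((n - s i) * 'C((n - s i).-1, k - a i))%N else 0%N.

(** For [s i <= n], split the lattice of rank [n.+1 - s i] along its last element: two copies of
    rank [n - s i], one of them a level higher, joined by one relation per set. *)
Lemma stage_edges_rec i n k :
  stage_edges i n.+1 k = (stage_edges i n k + (if k is k'.+1 then stage_edges i n k' else 0)
    + (if s i <= n then (if a i <= k then 'C(n - s i, k - a i) else 0) else 0))%N.
Proof.
rewrite /stage_edges; case: (leqP (s i) n) => [le_sn | lt_ns]; last first.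
  have ->: (n.+1 - s i = 0)%N by lia.
  have ->: (n - s i = 0)%N by lia.
  by case: k => [|k]; rewrite ?mul0n !if_same.
rewrite subSn //=; move: (n - s i)%N => r.
case: (leqP (a i) k) => [le_ak | lt_ka]; last first.
  case: k lt_ka => [|k] lt_ka //=.
  by case: leqP => //; lia.
case: k le_ak => [|k] le_ak.
  have ->: a i = 0%N by lia.
  by rewrite !bin0; lia.
have [le_ak1|lt_ka1] := leqP (a i) k; last first.
  have ->: (k.+1 - a i = 0)%N by lia.
  by rewrite !bin0; lia.
rewrite subSn //; move: (k - a i)%N => j.
case: r => [|r] /=; first by rewrite !mul0n bin0n mul1n.
by rewrite binS; lia.
Qed.

(* The situation after the operators x_{N-1}, ..., x_n have been processed.
   [I] and [J] are graded and stable under the remaining operators, and [J] contains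
   everything in x_0 I + ... + x_{n-1} I that is killed by all the [f i].  The pairs with
   [s i < n] still have a nontrivial quotient algebra, on which x_n acts exactly and
   [f] is jointly surjective; the other ones are exhausted, i.e. annihilated by all
   remaining operators, and nothing is required of their surjectivity. *)
Record stage n (I J : nat -> {vspace L}) : Prop := Stage {
  stage_sub : forall k, (I k <= X n k)%VS;
  stage_stable : forall k l, (l < n)%N -> (x l @: I k <= I k.+1)%VS;
  stage_onto : forall k q, (forall i, (s i < n)%N -> q i \in D i n k) ->
    exists2 p, p \in I k & forall i, (s i < n)%N -> f i p = q i;
  stage_into : forall k i, (s i < n)%N -> (f i @: I k <= D i n k)%VS;
  stage_kill : forall k i l p, (n <= s i)%N -> (l < n)%N -> p \in I k -> x l (f i p) = 0;
  stage_ker : forall k, ((\sum_(l < n) x l @: I k) :&: \bigcap_(i : T) lker (f i)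
                          <= J k.+1)%VS
}.

Lemma mem_bigcap_lker (p : L) :
  (p \in \bigcap_(i : T) lker (f i))%VS = [forall i, f i p == 0].
Proof.
apply/idP/forallP => [pf i | pf].
  rewrite -memv_ker; move: p pf; apply/subvP.
  by apply: (@bigcapv_inf _ _ _ i).
rewrite memvE; apply/subv_bigcapP => i _.
by rewrite -memvE memv_ker pf.
Qed.

(* [stage_mul] and [stage_cap] correspond to passing from ideals I, J of the exterior
   algebra of V to their images modulo x_n, realised as x_n I and x_n J, and to the
   colon ideals (I : x_n), (J : x_n), realised as I and J intersected with ker x_n,
   with the degree shifted by one. *)
Lemma stage_mul n I J : (n < N)%N -> stage n.+1 I J ->
  stage n (fun k => x n @: I k)%VS (fun k => x n @: J k)%VS.
Proof.
move=> ltnN [Isub Istable Ionto Iinto Ikill Iker]; split.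
- by move=> k; apply: subv_trans (Xmul _ _) => //; apply: limgS.
- move=> k l ltln; apply/subvP => _ /memv_imgP[_ /memv_imgP[p pI ->] ->].
  rewrite xC memvN memv_img //.
  by apply: (subvP (Istable _ _ (leqW ltln))); apply: memv_img.
- move=> k q qD.
  have /fin_all_exists[q' q'D] : forall i, exists q', ((s i < n)%N -> q i = c i *: x n q')
      /\ ((s i < n.+1)%N -> q' \in D i n.+1 k).
    move=> i; have [ltsn|lesn] := ltnP (s i) n; last by exists 0; rewrite mem0v.
    have /memv_imgP[q' q'D qE] : q i \in (x n @: D i n.+1 k)%VS.
      by rewrite Dmul ?qD // (ltnW ltsn).
    exists ((c i)^-1 *: q'); split=> _; last exact: memvZ.
    by rewrite linearZ /= scalerA mulfV ?scale1r.
  have [p pI fp] := Ionto k q' (fun i => (q'D i).2).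
  exists (x n p); first exact: memv_img.
  by move=> i ltsn; rewrite fx fp ?(q'D i).1 // ltnW.
- move=> k i ltsn; apply/subvP => _ /memv_imgP[_ /memv_imgP[p pI ->] ->].
  rewrite fx memvZ // -Dmul ?(ltnW ltsn) // memv_img //.
  by apply: (subvP (Iinto _ _ _)); [lia | apply: memv_img].
- move=> k i l _ lens ltln /memv_imgP[p pI ->].
  rewrite fx linearZ /=; have [ltns|lesn] := ltnP n (s i).
    by rewrite (Ikill k) ?linear0 ?scaler0.
  (* The pair becomes exhausted at exactly this stage, so [Dkill] takes over from [Ikill]. *)
  have {lesn lens} sE : s i = n by lia.
  rewrite (Dkill (i := i) (k := k)) ?scaler0 ?sE // -Dmul ?sE ?leqnn // memv_img //.
  by apply: (subvP (Iinto _ _ _)); [rewrite sE | apply: memv_img].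
(* Write w = x_n u. For the pairs not yet exhausted, x_n kills f_i u, so exactness on [D] gives f_i
   u = c_i x_n q_i, and joint surjectivity gives p in I with f_i p = q_i. Replacing u by u - x_n p
   keeps w and lands in J. *)
move=> k; apply/subvP => w; rewrite memv_cap mem_bigcap_lker => /andP[wS /forallP wf].
have {wS} /memv_imgP[u uS wE] : (w \in x n @: \sum_(l < n) x l @: I k)%VS.
  rewrite limg_sum; move: w wS {wf}; apply/subvP/subv_sumP => l _.
  apply: (sumv_sup l) => //; apply/subvP => _ /memv_imgP[_ /memv_imgP[p pI ->] ->].
  by rewrite xC memvN !memv_img.
have uI : u \in I k.+1.
  move: u uS {wE}; apply/subvP/subv_sumP => l _; apply: Istable.
  exact: leqW.
have uf i : x n (f i u) = 0.
  have /eqP := wf i; rewrite wE fx => /eqP.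
  by rewrite scaler_eq0 (negPf (c_neq0 i)) => /eqP.
have /fin_all_exists[q qD] : forall i, exists q, ((s i < n.+1)%N -> f i u = c i *: x n q)
      /\ ((s i < n.+1)%N -> q \in D i n.+1 k).
  move=> i; have [ltsn|lesn] := ltnP (s i) n.+1; last by exists 0; rewrite mem0v.
  have : f i u \in (D i n.+1 k.+1 :&: lker (x n))%VS.
    rewrite memv_cap memv_ker uf eqxx andbT.
    by apply: (subvP (Iinto _ _ ltsn)); apply: memv_img.
  have le : (s i <= n < N)%N by rewrite -ltnS ltsn.
  move/(subvP (Dker _ le)); rewrite -Dmul // => /memv_imgP[q qD fE].
  exists ((c i)^-1 *: q); split=> _; last exact: memvZ.
  by rewrite linearZ /= scalerA mulfV ?scale1r.
have [p pI fp] := Ionto k q (fun i => (qD i).2).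
have -> : w = x n (u - x n p) by rewrite linearB /= xx subr0.
apply/memv_img/(subvP (Iker _)); rewrite memv_cap mem_bigcap_lker; apply/andP; split.
  rewrite big_ord_recr /= memv_add ?memvN ?memv_img //.
apply/forallP => i; rewrite linearB /= fx subr_eq0.
(* For an exhausted pair, f_i vanishes on both x_n p and u, since u is a sum of elements of x_l
   I. *)
have [ltsn|lens] := ltnP (s i) n.+1; first by rewrite fp // (qD i).1.
rewrite (Ikill k i n p) // scaler0; move: u uS {wE uI uf qD}.
suff : (\sum_(l < n) x l @: I k <= lker (f i))%VS.
  by move/subvP => sub u /sub; rewrite memv_ker.
apply/subv_sumP => l _; apply/subvP => _ /memv_imgP[p' p'I ->].
by rewrite memv_ker fx (Ikill k) ?scaler0 // leqW.
Qed.

Lemma stage_cap n I J : (n < N)%N -> stage n.+1 I J ->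
  stage n (fun k => I k.+1 :&: lker (x n))%VS (fun k => J k.+1 :&: lker (x n))%VS.
Proof.
move=> ltnN [Isub Istable Ionto Iinto Ikill Iker]; split.
- by move=> k; apply: subv_trans (Xker _ _) => //; apply: capvS.
- move=> k l ltln; apply/subvP => _ /memv_imgP[p + ->].
  rewrite !memv_cap !memv_ker => /andP[pI /eqP xp0].
  rewrite xC xp0 linear0 oppr0 eqxx andbT.
  by apply: (subvP (Istable _ _ (leqW ltln))); apply: memv_img.
- move=> k q qD.
  have /fin_all_exists[q' q'D] : forall i, exists q', ((s i < n)%N -> q i = c i *: x n q')
      /\ ((s i < n.+1)%N -> q' \in D i n.+1 k).
    move=> i; have [ltsn|lesn] := ltnP (s i) n; last by exists 0; rewrite mem0v.
    have /memv_imgP[q' q'D qE] : q i \in (x n @: D i n.+1 k)%VS.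
      by rewrite Dmul ?qD // (ltnW ltsn).
    exists ((c i)^-1 *: q'); split=> _; last exact: memvZ.
    by rewrite linearZ /= scalerA mulfV ?scale1r.
  have [p pI fp] := Ionto k q' (fun i => (q'D i).2).
  exists (x n p); first rewrite memv_cap memv_ker xx eqxx andbT.
    by apply: (subvP (Istable _ _ (leqnn _))); apply: memv_img.
  by move=> i ltsn; rewrite fx fp ?(q'D i).1 // ltnW.
- move=> k i ltsn; apply/subvP => _ /memv_imgP[p + ->].
  rewrite !memv_cap !memv_ker => /andP[pI /eqP xp0].
  apply: (subvP (Dker _ _)); first by rewrite (ltnW ltsn).
  rewrite memv_cap memv_ker; apply/andP; split.
    by apply: (subvP (Iinto _ _ _)); [lia | apply: memv_img].
  rewrite -(inj_eq (scalerI (c_neq0 i))) -fx xp0 linear0 scaler0 //.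
- move=> k i l p lens ltln; rewrite memv_cap memv_ker => /andP[pI /eqP xp0].
  have [ltns|lesn] := ltnP n (s i); first by rewrite (Ikill k.+1) // leqW.
  have {lesn lens} sE : s i = n by lia.
  apply: (Dkill (i := i) (k := k)); rewrite sE //.
  apply: (subvP (Dker _ _)); first by rewrite sE leqnn.
  rewrite memv_cap memv_ker; apply/andP; split.
    by apply: (subvP (Iinto _ _ _)); [lia | apply: memv_img].
  rewrite -(inj_eq (scalerI (c_neq0 i))) -fx xp0 linear0 scaler0 //.
move=> k; apply/subvP => w; rewrite memv_cap => /andP[wS wf].
rewrite memv_cap memv_ker; apply/andP; split.
  apply: (subvP (Iker _)); rewrite memv_cap wf andbT big_ord_recr /=.
  apply: (subvP (addvSl _ _)); move: w wS {wf}; apply/subvP/subv_sumP => l _.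
  by apply: (sumv_sup l) => //; apply/limgS/capvSl.
rewrite -memv_ker; move: w wS {wf}; apply/subvP/subv_sumP => l _.
apply/subvP => _ /memv_imgP[p + ->]; rewrite memv_cap !memv_ker => /andP[_ /eqP xp0].
by rewrite xC xp0 linear0 oppr0.
Qed.

(** Rank-nullity for x_n splits dim I_k into the parts handled by [stage_mul] in degree k and by
    [stage_cap] in degree k - 1. The two induction hypotheses leave one extra dim (x_n I_k) on the
    left and one extra dim (J_{k+1} cap ker x_n) on the right; [step] compares these. *)
Theorem stage_dim n I J k : (n <= N)%N -> stage n I J ->
  ((n - k) * \dim (I k) <= k.+1 * \dim (J k.+1) + \sum_i stage_edges i n k)%N.
Proof.
elim: n k I J => [|n IH] k I J lenN st; first by rewrite sub0n.
have IHm := IH _ _ _ (ltnW lenN) (stage_mul lenN st).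
have IHc := IH _ _ _ (ltnW lenN) (stage_cap lenN st).
have [Isub Istable _ Iinto Ikill Iker] := st.
have dI j := limg_ker_dim (x n) (I j).
have dJ j := limg_ker_dim (x n) (J j).
pose e i := (if s i <= n then (if a i <= k then 'C(n - s i, k - a i) else 0) else 0)%N.
(* Modulo J, the space x_n I is only as large as its image under the f i, while x_n I
   itself lies in ker x_n. *)
have step : (\dim (x n @: I k) <= \dim (J k.+1 :&: lker (x n)) + \sum_i e i)%N.
  apply: leq_trans (dimv_bigcap_lker (index_enum T) f _) _; apply: leq_add.
    apply/dimvS; rewrite subv_cap; apply/andP; split.
      apply: subv_trans (Iker k); apply: capvS => //.
      by rewrite big_ord_recr /= addvSr.
    apply: subv_trans (capvSl _ _) _; apply/subvP => _ /memv_imgP[p _ ->].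
    by rewrite memv_ker xx.
  apply: leq_sum => i _; rewrite /e; case: (leqP (s i) n) => [lesn | ltns].
    have le : (s i <= n < N)%N by rewrite lesn.
    apply: leq_trans (Ddim _ le); rewrite -Dmul //; apply: dimvS.
    apply/subvP => _ /memv_imgP[_ /memv_imgP[p pI ->] ->].
    rewrite fx memvZ // memv_img //.
    by apply: (subvP (Iinto _ _ _)) => //; apply: memv_img.
  rewrite leqn0 dimv_eq0 -subv0; apply/subvP => _ /memv_imgP[_ /memv_imgP[p pI ->] ->].
  by rewrite fx (Ikill k) // scaler0 mem0v.
rewrite (eq_bigr _ (fun i _ => stage_edges_rec i n k)) !big_split /=.
rewrite -/(\sum_i e i)%N.
have := IHm k; have := dI k; have := dJ k.+1.
move: (\sum_(i : T) e i)%N step => {e} d step.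
case: k step => [|k] step.
  (* In degree 0 the kernel part has no lower degree to recurse to, but it vanishes. *)
  have -> : (I 0%N :&: lker (x n) = 0)%VS.
    by apply/eqP; rewrite -subv0 -(Xker0 lenN); apply: capvS.
  rewrite dimv0 !subn0 sum_nat_const muln0 => dJ1 dI0 dIm.
  nia.
move=> dJk dIk dIm; have dIc := IHc k; rewrite subSS -dIk -dJk.
have [lt_kn | le_nk] := ltnP k n; last by have -> : (n - k = 0)%N by lia.
have E : (n - k = (n - k.+1).+1)%N by lia.
by rewrite mulnDr {2}E mulSn; lia.
Qed.

End Stage.

(** * The exterior algebra *)

Section Exterior.
Variable K : fieldType.

(* The exterior algebra on e_0, ..., e_{n-1}: the pair (u, w) of [ext n.+1] stands for
   u + e_n /\ w. *)
Fixpoint ext (n : nat) : vectType K :=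
  if n is n'.+1 then (ext n' * ext n')%type : vectType K else K^o : vectType K.

(* Left multiplication by the vector sum_(l < n) c l * e_l. *)
Fixpoint wedge_fun n (c : nat -> K) : ext n -> ext n :=
  if n is n'.+1 then fun p => (wedge_fun c p.1, c n' *: p.1 - wedge_fun c p.2)
  else fun _ => 0.

Lemma wedge_fun_linear n c : linear (@wedge_fun n c).
Proof.
elim: n => [|n IH] k p q /=; first by rewrite scaler0 addr0.
rewrite !IH /=; congr pair; rewrite /= scalerDr opprD -!scalerN !scalerA mulrC.
by rewrite scalerBr scalerN scalerA addrACA.
Qed.

HB.instance Definition _ n c :=
  GRing.isLinear.Build K (ext n) (ext n) _ (@wedge_fun n c) (@wedge_fun_linear n c).

Definition wedge n c : 'End(ext n) := linfun (@wedge_fun n c).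

Lemma wedgeS n c (u w : ext n) :
  wedge n.+1 c (u, w) = (wedge n c u, c n *: u - wedge n c w).
Proof. by rewrite !lfunE. Qed.

Lemma wedge0 c (p : ext 0) : wedge 0 c p = 0.
Proof. by rewrite lfunE. Qed.

Lemma wedge_sq n c p : wedge n c (wedge n c p) = 0.
Proof.
elim: n p => [|n IH] p; first by rewrite wedge0.
case: p => u w; rewrite !wedgeS IH; congr pair.
by rewrite linearB linearZ /= IH subr0 subrr.
Qed.

Lemma wedge_linear n c d k p :
  wedge n (fun l => k * c l + d l) p = k *: wedge n c p + wedge n d p.
Proof.
elim: n p => [|n IH] p; first by rewrite !wedge0 scaler0 addr0.
case: p => u w; rewrite !wedgeS !IH; congr pair.
by rewrite /= scalerDl scalerBr scalerA opprD addrACA.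
Qed.

Lemma eq_wedge n c d : (forall l, (l < n)%N -> c l = d l) -> wedge n c =1 wedge n d.
Proof.
elim: n => [|n IH] eqc p; first by rewrite !wedge0.
case: p => u w; rewrite !wedgeS eqc // !IH // => l ltln; exact/eqc/leqW.
Qed.

Lemma wedgeC n c d p : wedge n c (wedge n d p) = - wedge n d (wedge n c p).
Proof.
have := wedge_sq (fun l => 1 * c l + d l) p.
rewrite !wedge_linear !scale1r !linearD /= !wedge_sq add0r addr0 => /eqP.
by rewrite addr_eq0 => /eqP.
Qed.

Definition evar n l := wedge n (fun z => (z == l)%:R).

Lemma evarE n l (u w : ext n) :
  evar n.+1 l (u, w) = if l == n then (0, u) else (evar n l u, - evar n l w).
Proof.
rewrite /evar wedgeS eq_sym; case: eqP => [->|_]; last by rewrite scale0r add0r.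
have z p : wedge n (fun z => (z == n)%:R) p = 0.
  rewrite (@eq_wedge _ _ (fun z => 0 * 0 + 0)) => [|z ltzn]; last first.
    by rewrite mul0r addr0 ltn_eqF.
  by have := wedge_linear (fun=> 0) (fun=> 0) (-1) p; rewrite scaleN1r addNr mulr0 mul0r.
by rewrite !z scale1r subr0.
Qed.

(* Spanned by the monomials e_S with |S| = j and S containing every l < n such that
   F l. *)
Fixpoint supp (F : pred nat) n (j : nat) : {vspace ext n} :=
  if n is n'.+1 then
    ((linfun fst : 'Hom(ext n'.+1, ext n')) @^-1: (if F n' then 0 else supp F n' j) :&:
     (linfun snd : 'Hom(ext n'.+1, ext n')) @^-1: (if j is j'.+1 then supp F n' j' else 0))%VS
  else if j == 0%N then fullv else 0%VS.

Lemma mem_supp F n j (u w : ext n) :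
  ((u, w) \in supp F n.+1 j) =
  (u \in if F n then 0%VS else supp F n j) &&
  (w \in if j is j'.+1 then supp F n j' else 0%VS).
Proof. by rewrite [LHS]/= memv_cap -!memv_preim !lfunE /=; case: (F n); case: j. Qed.

Lemma eq_supp (F F' : pred nat) n j :
  (forall l, (l < n)%N -> F l = F' l) -> supp F n j = supp F' n j.
Proof.
elim: n j => // n IH j eqF /=.
have IH' j' : supp F n j' = supp F' n j' by apply: IH => l ln; apply/eqF/leqW.
by case: j => [|j]; rewrite eqF ?leqnn // !IH'.
Qed.

Lemma supp_kill (F : pred nat) n j l p : (l < n)%N -> F l -> p \in supp F n j -> evar n l p = 0.
Proof.
move=> + Fl; elim: n j p => // n IH j [u w] ltln.
rewrite mem_supp evarE; case: (eqVneq l n) => [En|ln].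
  have -> : F n by rewrite -En.
  by rewrite memv0 => /andP[/eqP -> _].
have {ln}ltln : (l < n)%N by lia.
case/andP=> uS wS; have -> : evar n l u = 0.
  by case: ifP uS => _; [rewrite memv0 => /eqP ->; rewrite linear0 | apply: IH].
suff -> : evar n l w = 0 by rewrite oppr0.
by case: j wS {uS} => [|j]; [rewrite memv0 => /eqP ->; rewrite linear0 | apply: IH].
Qed.

Lemma supp0 (F : pred nat) n l : (l < n)%N -> F l -> supp F n 0 = 0%VS.
Proof.
move=> + Fl; elim: n => // n IH ltln; apply/eqP; rewrite -subv0; apply/subvP => -[u w].
rewrite mem_supp !memv0 => /andP[uS /eqP ->].
rewrite -pair_eqE /= eqxx andbT; move: uS; case: ifP => [_|Fn]; first by rewrite memv0.
rewrite IH ?memv0 // ltn_neqAle -ltnS ltln andbT.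
by apply/negP => /eqP En; rewrite -En Fl in Fn.
Qed.

Lemma supp_mul (F : pred nat) n j l : (l < n)%N -> ~~ F l ->
  (evar n l @: supp F n j = supp (predU1 l F) n j.+1)%VS.
Proof.
move=> + Fl; elim: n j => // n IH j ltln; apply/eqP; rewrite eqEsubv; apply/andP; split.
  apply/subvP => _ /memv_imgP[[u w] + ->]; rewrite mem_supp evarE.
  case: (eqVneq l n) => [En|ln] /andP[uS wS].
    rewrite mem_supp /= En eqxx /= memv0 eqxx /=.
    have Fn : F n = false by rewrite -En (negPf Fl).
    by rewrite Fn in uS; rewrite (@eq_supp _ F) // => z ltz /=; rewrite ltn_eqF.
  have {ln}ltln : (l < n)%N by lia.
  rewrite mem_supp /= gtn_eqF //= memvN; apply/andP; split.
    case: ifP uS => _; first by rewrite !memv0 => /eqP ->; rewrite linear0.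
    by rewrite -IH //; apply: memv_img.
  case: j wS {uS} => [|j]; first by rewrite !memv0 => /eqP ->; rewrite linear0 mem0v.
  by rewrite -IH //; apply: memv_img.
apply/subvP => -[u w]; rewrite mem_supp /=.
case: (eqVneq n l) => [En|nl] /=.
  rewrite memv0 (@eq_supp _ F) => [/andP[/eqP -> wS]|z ltz /=]; last first.
    by rewrite -En ltn_eqF.
  have -> : (0, w) = evar n.+1 l (w, 0) by rewrite -En evarE eqxx.
  have Fn : F n = false by rewrite En (negPf Fl).
  by apply: memv_img; rewrite mem_supp Fn wS; case: (j) => *; rewrite mem0v.
have {nl}ltln : (l < n)%N by lia.
case/andP=> uS wS.
have [u' u'S ->] : exists2 u', u' \in (if F n then 0%VS else supp F n j) & u = evar n l u'.
  case: ifP uS => _; first by rewrite memv0 => /eqP ->; exists 0; rewrite ?mem0v ?linear0.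
  by rewrite -IH // => /memv_imgP.
have [w' w'S ->] : exists2 w', w' \in (if j is j'.+1 then supp F n j' else 0%VS)
    & w = - evar n l w'.
  case: j wS {uS u'S} => [|j].
    rewrite (@supp0 _ _ l) //= ?eqxx // memv0 => /eqP ->.
    by exists 0; rewrite ?mem0v // linear0 oppr0.
  rewrite -IH // => /memv_imgP[w' w'S ->]; exists (- w'); rewrite ?memvN //.
  by rewrite linearN opprK.
have -> : (evar n l u', - evar n l w') = evar n.+1 l (u', w').
  by rewrite evarE ltn_eqF.
by apply: memv_img; rewrite mem_supp u'S w'S.
Qed.

(** Exactness of multiplication by e_l: what it kills is divisible by e_l. The degree [j] stays,
    whereas [supp_mul] raises it. *)
Lemma supp_ker (F : pred nat) n j l p : (l < n)%N -> ~~ F l -> p \in supp F n j ->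
  evar n l p = 0 -> p \in supp (predU1 l F) n j.
Proof.
move=> + Fl; elim: n j p => // n IH j [u w] ltln; rewrite !mem_supp evarE.
case: (eqVneq l n) => [En|ln] /andP[uS wS].
  case=> u0; rewrite u0 /= En eqxx mem0v /=; case: j wS {uS} => // j.
  by rewrite -(@eq_supp F) // => z ltz /=; rewrite ltn_eqF.
have {ln}ltln' : (l < n)%N by lia.
case=> xu0 /eqP; rewrite oppr_eq0 => /eqP xw0; rewrite /= gtn_eqF //=.
apply/andP; split; first by case: ifP uS => // _ uS; apply: IH.
by case: j wS {uS} => // j wS; apply: IH.
Qed.

Lemma dim_pair_preim (V1 V2 : vectType K) (U1 : {vspace V1}) (U2 : {vspace V2}) :
  \dim ((linfun fst : 'Hom((V1 * V2)%type, V1)) @^-1: U1 :&: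
        (linfun snd : 'Hom((V1 * V2)%type, V2)) @^-1: U2)%VS = (\dim U1 + \dim U2)%N.
Proof.
set P := (_ :&: _)%VS; rewrite -(limg_ker_dim (linfun fst) P) addnC.
have memP u w : ((u, w) \in P) = (u \in U1) && (w \in U2).
  by rewrite memv_cap -!memv_preim !lfunE.
congr addn.
  congr (\dim _); apply/vspaceP => u; apply/memv_imgP/idP => [[[u' w] + ->]|uU].
    by rewrite memP lfunE => /andP[].
  by exists (u, 0); rewrite ?memP ?uU ?mem0v ?lfunE /=.
rewrite -(@limg_dim_eq _ _ _ (linfun snd)).
  congr (\dim _); apply/vspaceP => w; apply/memv_imgP/idP => [[[u w'] + ->]|wU].
    by rewrite memv_cap memP lfunE => /andP[/andP[]].
  exists (0, w); last by rewrite lfunE.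
  by rewrite memv_cap memP memv_ker lfunE wU mem0v /= eqxx.
apply/eqP; rewrite -subv0; apply/subvP => -[u w].
rewrite !memv_cap !memv_ker !lfunE /= => /andP[/andP[_ /eqP ->] /eqP ->].
by rewrite mem0v.
Qed.

Lemma dim_supp F n j (c := count F (iota 0 n)) :
  \dim (supp F n j) = if (c <= j)%N then 'C(n - c, j - c) else 0%N.
Proof.
rewrite {}/c; elim: n j => [|n IH] j.
  rewrite /= subn0; case: j => [|j] /=; last by rewrite dimv0.
  by rewrite dimvf.
have le_c : (count F (iota 0 n) <= n)%N by rewrite -[leqRHS](size_iota 0) count_size.
rewrite [supp _ _ _]/= dim_pair_preim.
have -> : count F (iota 0 n.+1) = (count F (iota 0 n) + F n)%N.
  by rewrite -addn1 iotaD count_cat /= add0n addn0.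
move: (count _ _) le_c IH => c le_cn IH; case: (F n); rewrite /= ?dimv0 ?addn0 ?add0n ?addn1.
  by case: j => [|j]; rewrite ?dimv0 // IH ltnS subSS.
rewrite IH; case: j => [|j].
  by rewrite dimv0 addn0 leqn0; case: eqP => // ->; rewrite !bin0.
rewrite IH; have [lecj|ltjc] := leqP c j.
  by rewrite leqW // !subSn // binS.
have [lecj1|//] := leqP c j.+1.
have -> : (j.+1 - c = 0)%N by lia.
by rewrite !bin0.
Qed.

Fixpoint ext_one n : ext n := if n is n'.+1 then (ext_one n', 0) else 1.

(** Every monomial arises from 1 by successive multiplications; this serves to show that a change of
    basis is onto. *)
Lemma ext_gen n (S : {vspace ext n}) : ext_one n \in S ->
  (forall l, (l < n)%N -> (evar n l @: S <= S)%VS) -> S = fullv.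
Proof.
elim: n S => [|n IH] S oneS evS; apply/eqP; rewrite eqEsubv subvf /=; apply/subvP.
  by move=> p _; rewrite -[p]mulr1; apply: (memvZ (p : K) oneS).
have embE : linear (fun u : ext n => ((u, 0) : ext n.+1)).
  by move=> k u v; congr pair; rewrite /= scaler0 addr0.
pose emb : {linear ext n -> ext n.+1} :=
  HB.pack (fun u : ext n => ((u, 0) : ext n.+1))
    (GRing.isLinear.Build K (ext n) (ext n.+1) _ _ embE).
have embE' u : linfun emb u = (u, 0) by rewrite lfunE.
have inS u : (u, 0) \in S.
  suff : (linfun emb @^-1: S)%VS = fullv by move/vspaceP/(_ u); rewrite memvf -memv_preim embE'.
  apply: IH => [|l ltln]; first by rewrite -memv_preim embE'.
  apply/subvP => _ /memv_imgP[p + ->]; rewrite -!memv_preim !embE' => pS.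
  have -> : (evar n l p, 0) = evar n.+1 l (p, 0).
    by rewrite evarE ltn_eqF // linear0 oppr0.
  by apply: (subvP (evS _ (leqW ltln))); apply: memv_img.
move=> [u w] _; have -> : ((u, w) : ext n.+1) = (u, 0) + evar n.+1 n (w, 0).
  by rewrite evarE eqxx; congr pair; rewrite /= ?addr0 ?add0r.
by rewrite memvD //; apply: (subvP (evS _ (leqnn _))); apply: memv_img.
Qed.

(* [lift n] is the map of the exterior algebra that sends e_l to [U l] and 1 to v0. *)
Section Lift.
Variables (L : vectType K) (U : nat -> 'End(L)) (v0 : L).
Hypothesis UU : forall l p, U l (U l p) = 0.
Hypothesis UC : forall l l' p, U l (U l' p) = - U l' (U l p).

Fixpoint ext_lift n : ext n -> L :=
  if n is n'.+1 then fun p => ext_lift p.1 + U n' (ext_lift p.2)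
  else fun p => (p : K) *: v0.

Lemma ext_lift_linear n : linear (@ext_lift n).
Proof.
elim: n => [|n IH] k p q /=; first by rewrite scalerDl scalerA.
by rewrite !IH linearD linearZ /= scalerDr addrACA.
Qed.

HB.instance Definition _ n :=
  GRing.isLinear.Build K (ext n) L _ (@ext_lift n) (@ext_lift_linear n).

Definition lift n : 'Hom(ext n, L) := linfun (@ext_lift n).

Lemma liftE n (u w : ext n) : lift n.+1 (u, w) = lift n u + U n (lift n w).
Proof. by rewrite !lfunE. Qed.

Lemma lift0 (p : ext 0) : lift 0 p = (p : K) *: v0.
Proof. by rewrite lfunE. Qed.

Lemma lift_one n : lift n (ext_one n) = v0.
Proof.
elim: n => [|n IH]; first by rewrite lift0 scale1r.
by rewrite [ext_one _]/= liftE IH !linear0 addr0.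
Qed.

Lemma lift_evar n l p : (l < n)%N -> lift n (evar n l p) = U l (lift n p).
Proof.
elim: n p => // n IH [u w] ltln; rewrite evarE liftE; case: (eqVneq l n) => [->|ln].
  by rewrite liftE linear0 add0r linearD /= UU addr0.
have {ln}ltln' : (l < n)%N by lia.
by rewrite liftE IH // linearN /= IH // linearN linearD /= UC.
Qed.

Lemma lift_supp (G : nat -> {vspace L}) n j : v0 \in G 0%N ->
  (forall l k, (l < n)%N -> (U l @: G k <= G k.+1)%VS) ->
  (lift n @: supp pred0 n j <= G j)%VS.
Proof.
move=> v0G UG; apply/subvP => _ /memv_imgP[p + ->].
elim: n UG j p => [|n IH] UG j p.
  case: j => [_|j]; first by rewrite lift0 memvZ.
  by rewrite [supp _ _ _]/= memv0 => /eqP ->; rewrite linear0 mem0v.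
have IH' := IH (fun l k ltln => UG l k (leqW ltln)).
case: p => u w; rewrite mem_supp liftE /= => /andP[uS wS].
rewrite memvD ?IH' //; case: j wS {uS} => [|j] wS.
  by move: wS; rewrite memv0 => /eqP ->; rewrite !linear0 mem0v.
by apply: (subvP (UG _ _ (leqnn _))); rewrite memv_img ?IH'.
Qed.
End Lift.

End Exterior.

(** * Generic position *)

Definition infinite_field (K : fieldType) := forall r : seq K, exists c, c \notin r.

Section Generic.
Variables (K : fieldType) (V : vectType K).
Hypothesis Kinf : infinite_field K.

(** A space over an infinite field is not a finite union of proper subspaces. If v avoids [Us] but
    lies in U, take w outside U and search the line w + c v, which misses U. *)
Lemma avoid_subspaces (Us : seq {vspace V}) :
  all (fun U => U != fullv) Us -> exists v, all (fun U : {vspace V} => v \notin U) Us.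
Proof.
elim: Us => [|U Us IH] /=; first by exists 0.
case/andP=> Uprop /IH[v vUs].
have [vU|vnU] := boolP (v \in U); last by exists v; rewrite vnU.
have [w _ wU] : exists2 w, w \in fullv & w \notin U.
  by apply/subvPn; apply: contraNN Uprop => sub; rewrite eqEsubv subvf.
(* A subspace not containing v meets the line in at most one point, so it excludes at most one c. *)
have [bad badP] : exists bad : seq K,
    forall c, c \notin bad -> all (fun U : {vspace V} => w + c *: v \notin U) Us.
  elim: Us vUs {IH} => [|U' Us IH] /=; first by exists [::].
  case/andP=> vU' /IH[bad badP].
  have [/memv_addP[u uU' [_ /vlineP[k ->] wE]]|no] := boolP (w \in U' + <[v]>)%VS.
    have c0U' : w + - k *: v \in U' by rewrite wE scaleNr addrK.
    move: (- k) c0U' => c0 c0U'; exists (c0 :: bad) => c.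
    rewrite inE negb_or => /andP[cc0 /badP ->]; rewrite andbT.
    apply: contra vU' => cU'; have := memvB cU' c0U'.
    rewrite opprD addrACA subrr add0r -scalerBl => /(memvZ (c - c0)^-1).
    by rewrite scalerA mulVf ?scale1r // subr_eq0.
  exists bad => c /badP ->; rewrite andbT; apply: contra no => cU'.
  by rewrite -(addrK (c *: v) w) memv_add // memvN memvZ // memv_line.
have [c cbad] := Kinf bad; exists (w + c *: v).
rewrite badP // andbT; apply: contra wU => wcU.
by rewrite -(addrK (c *: v) w) memvB // memvZ.
Qed.

(** Vectors are prepended one at a time, each outside the spans of the finitely many families that
    still have room. Controlling all tails [drop j es] lets a single list complete families of
    different sizes. *)
Lemma generic_completion (T : finType) (X : T -> seq V) (r : nat) :
  (forall i, free (X i)) -> (r <= \dim {:V})%N ->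
  exists es : seq V, [/\ size es = r, free es &
    forall i j, (j <= r)%N -> (size (X i) + (r - j) <= \dim {:V})%N ->
      free (X i ++ drop j es)].
Proof.
move=> Xfree; elim: r => [|r IH] ltrN.
  by exists [::]; split; rewrite ?nil_free // => i j _ _; rewrite cats0.
have [es [szes esfree esX]] := IH (ltnW ltrN).
have span_prop (Y : seq V) : (size Y < \dim {:V})%N -> <<Y>>%VS != fullv.
  move=> ltY; apply: contraTneq ltY => Yf; rewrite -leqNgt -Yf; exact: dim_span.
have [|v] := @avoid_subspaces
  (<<es>>%VS :: [seq <<X i ++ es>>%VS | i <- enum T & (size (X i) + r < \dim {:V})%N]).
  rewrite /= span_prop ?szes //; apply/allP => _ /mapP[i + ->].
  by rewrite mem_filter => /andP[lti _]; rewrite span_prop // size_cat szes.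
case/andP=> ves /allP vX; exists (v :: es); split=> [||i [|j] lej lesz] /=.
- by rewrite szes.
- by rewrite free_cons ves.
- rewrite subn0 in lesz; rewrite (perm_free (Y := v :: (X i ++ es))).
    rewrite free_cons; apply/andP; split.
      apply: vX; apply: map_f; rewrite mem_filter mem_enum andbT.
      by rewrite addnS in lesz.
    by have := esX i 0%N; rewrite drop0 subn0; apply => //; rewrite ltnW // -addnS.
  exact: (permEl (perm_catCA (X i) [:: v] es)).
- by apply: esX.
Qed.

End Generic.

Lemma wedge_supp (K : fieldType) n c j :
  (wedge n c @: supp K pred0 n j <= supp K pred0 n j.+1)%VS.
Proof.
apply/subvP => _ /memv_imgP[p + ->]; elim: n j p => [|n IH] j p.
  by rewrite wedge0 mem0v.
case: p => u w; rewrite wedgeS !mem_supp /= => /andP[uS wS].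
rewrite IH //= memvB ?memvZ //; case: j wS {uS} => [|j]; last exact: IH.
by rewrite memv0 => /eqP ->; rewrite linear0 mem0v.
Qed.

(** * Multiplication by vectors and changes of basis *)

Section VectorOperators.
Variables (K : fieldType) (V : vectType K) (N : nat) (e : N.-tuple V).
Hypothesis ebasis : basis_of fullv e.

Local Notation L := (ext K N).

Definition wcoef (v : V) (l : nat) : K := oapp (fun i => coord e i v) 0 (insub l).
Definition wop (v : V) : 'End(L) := wedge N (wcoef v).

Lemma wop_linear k v w p : wop (k *: v + w) p = k *: wop v p + wop w p.
Proof.
rewrite -wedge_linear; apply: eq_wedge => l _.
by rewrite /wcoef; case: insub => [i|] /=; rewrite ?linearP // mulr0 addr0.
Qed.

Lemma wop_sq v p : wop v (wop v p) = 0. Proof. exact: wedge_sq. Qed.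

Lemma wopC v w p : wop v (wop w p) = - wop w (wop v p). Proof. exact: wedgeC. Qed.

Lemma evar_wop l : evar K N l =1 wop e`_l.
Proof.
apply: eq_wedge => z ltzN; rewrite /wcoef insubT /=.
have [ltlN|leNl] := ltnP l N.
  by rewrite (coord_free (Ordinal ltlN) _ (basis_free ebasis)) -val_eqE /= eq_sym.
by rewrite nth_default ?size_tuple // linear0 ltn_eqF // (leq_trans ltzN).
Qed.

Lemma wop_span (S : {vspace L}) p (vs : seq V) w :
  (forall v, v \in vs -> wop v p \in S) -> w \in <<vs>>%VS -> wop w p \in S.
Proof.
elim: vs w => [|v vs IH] w vsS.
  rewrite span_nil memv0 => /eqP ->; have := wop_linear (-1) 0 0 p.
  by rewrite scaler0 addr0 scaleN1r addNr => ->; rewrite mem0v.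
rewrite span_cons => /memv_addP[_ /vlineP[k ->] [w' w'vs ->]].
rewrite wop_linear; apply: memvD; first by rewrite memvZ // vsS ?mem_head.
by apply: IH => // u uvs; rewrite vsS // inE uvs orbT.
Qed.

Definition wprod (vs : seq V) : 'End(L) := foldr (fun v g => (wop v \o g)%VF) \1%VF vs.

Lemma wprod_cons v vs p : wprod (v :: vs) p = wop v (wprod vs p).
Proof. by rewrite /= comp_lfunE. Qed.

Lemma wprod_cat vs ws p : wprod (vs ++ ws) p = wprod vs (wprod ws p).
Proof. by elim: vs => [|v vs IH]; rewrite ?id_lfunE // cat_cons !wprod_cons IH. Qed.

Lemma wprod_wop vs w p : wprod vs (wop w p) = (-1) ^+ size vs *: wop w (wprod vs p).
Proof.
elim: vs => [|v vs IH]; first by rewrite !id_lfunE scale1r.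
by rewrite !wprod_cons IH linearZ /= wopC scalerN -scaleNr exprS mulN1r.
Qed.

Lemma wprod_kill vs w p : w \in <<vs>>%VS -> wop w (wprod vs p) = 0.
Proof.
move=> wvs; apply/eqP; rewrite -memv0; apply: wop_span wvs => v.
elim: vs => // u vs IH; rewrite inE wprod_cons => /predU1P[-> | vvs].
  by rewrite wop_sq mem0v.
by have := IH vvs; rewrite memv0 wopC => /eqP ->; rewrite linear0 oppr0 mem0v.
Qed.

Lemma wprod_dep vs p : ~~ free vs -> wprod vs p = 0.
Proof.
elim: vs => [|v vs IH]; first by rewrite nil_free.
rewrite free_cons negb_and negbK wprod_cons => /orP[vvs | /IH ->]; last exact: linear0.
exact: wprod_kill.
Qed.

Lemma wprod_supp vs j :
  (wprod vs @: supp K pred0 N j <= supp K pred0 N (j + size vs))%VS.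
Proof.
elim: vs => [|v vs IH]; first by rewrite lim1g addn0.
rewrite /= limg_comp addnS; apply: subv_trans (wedge_supp _ _ _).
exact: limgS.
Qed.

Section Frame.
Variable u : seq V.
Hypotheses (ufree : free u) (usize : size u = N).

Lemma frame_full : <<u>>%VS = fullv.
Proof.
apply/eqP; rewrite eqEdim subvf /=; move: ufree; rewrite /free usize => /eqP ->.
by rewrite (size_basis ebasis).
Qed.

(** The automorphism of the exterior algebra induced by the change of basis from [e] to [u]. *)
Definition frame : 'Hom(L, L) := lift (fun l => wop u`_l) (ext_one K N) N.

Lemma frame_evar l p : (l < N)%N -> frame (evar K N l p) = wop u`_l (frame p).
Proof. by apply: lift_evar => *; [apply: wop_sq | apply: wopC]. Qed.

(** The image contains 1 and is stable under each u_l, hence, as [u] spans, under each e_l. *)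
Lemma frame_limg : limg frame = fullv.
Proof.
apply: ext_gen.
  rewrite -[X in X \in _](lift_one (fun l => wop u`_l) (ext_one K N) N).
  exact/memv_img/memvf.
move=> l ltlN; apply/subvP => _ /memv_imgP[_ /memv_imgP[p _ ->] ->].
rewrite evar_wop; apply: (@wop_span _ _ u); last by rewrite frame_full memvf.
move=> v /(nthP 0)[z ltz <-]; rewrite -frame_evar -?usize //.
exact/memv_img/memvf.
Qed.

Lemma frame_lker : lker frame = 0%VS.
Proof.
apply/eqP; rewrite -dimv_eq0; have := limg_ker_dim frame fullv.
by rewrite frame_limg capfv; lia.
Qed.

Lemma frame_inj : injective frame.
Proof. by apply/lker0P; rewrite frame_lker. Qed.

Lemma dim_frame S : \dim (frame @: S) = \dim S.
Proof. by apply: limg_dim_eq; rewrite frame_lker capv0. Qed.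

Lemma frame_supp j : (frame @: supp K pred0 N j)%VS = supp K pred0 N j.
Proof.
apply/eqP; rewrite eqEdim dim_frame leqnn andbT.
apply: lift_supp => [|l k _]; last exact: wedge_supp.
elim: (N) => [|n IH]; first exact: memvf.
by rewrite [ext_one _ _]/= mem_supp IH mem0v.
Qed.

Lemma wprod_frame z j : (z <= N)%N ->
  (wprod (take z u) @: supp K pred0 N j = frame @: supp K (fun l => l < z)%N N (j + z))%VS.
Proof.
move=> lezN.
(* The factors are multiplied in from u_(z-1) down to u_0, each adding one forced position to the
   monomials. *)
suff gen m : (m <= z)%N -> (wprod (drop (z - m) (take z u)) @: supp K pred0 N j
    = frame @: supp K (fun l => z - m <= l < z)%N N (j + m))%VS.
  by have := gen z (leqnn z); rewrite subnn drop0.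
elim: m => [|m IH] lemz.
  rewrite subn0 drop_oversize ?size_take_min ?geq_minl // lim1g addn0 -frame_supp.
  by congr (_ @: _)%VS; apply: eq_supp => l _; case: leqP => //= lezl; rewrite ltnNge lezl.
have ltz : (z - m.+1 < N)%N by lia.
rewrite (drop_nth 0) ?size_take_min ?usize; last by lia.
rewrite nth_take; last by lia.
have -> : ((z - m.+1).+1 = z - m)%N by lia.
rewrite /= limg_comp IH; last by lia.
rewrite addnS (@eq_supp _ (fun l => z - m.+1 <= l < z)%N
  (predU1 (z - m.+1)%N (fun l => z - m <= l < z)%N)); last first.
  by move=> l _ /=; lia.
rewrite -(@supp_mul _ (fun l => z - m <= l < z)%N _ _ _ ltz); last by lia.
rewrite -!limg_comp; apply: eq_in_limg => p _.
by rewrite !comp_lfunE frame_evar.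
Qed.

End Frame.
End VectorOperators.

(** * The ideals of a system of pairs *)

(** Counterpart of [dimv_bigcap_lker]: prescribing 0 for the first map shows that the others stay
    jointly onto inside its kernel. *)
Lemma leq_sum_dimv_onto (K : fieldType) (L L' : vectType K) (T : eqType) (r : seq T)
    (f : T -> 'Hom(L, L')) (D : T -> {vspace L'}) (U : {vspace L}) :
  uniq r ->
  (forall q, {in r, forall i, q i \in D i} ->
     exists2 p, p \in U & {in r, forall i, f i p = q i}) ->
  (\sum_(i <- r) \dim (D i) + \dim (U :&: \bigcap_(i <- r) lker (f i)) <= \dim U)%N.
Proof.
elim: r U => [|i r IH] U /=; first by rewrite !big_nil capvf.
case/andP=> inr runiq onto; rewrite !big_cons capvA -(limg_ker_dim (f i) U) addnC.
rewrite addnCA addnC leq_add //.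
  rewrite addnC; apply: IH => // q qD.
  have [|p pU fp] := onto (fun j => if j == i then 0 else q j).
    move=> j; rewrite inE; case: eqP => [_|_] /= jr; [exact: mem0v | exact: qD].
  exists p; last by move=> j jr; rewrite fp ?inE ?jr ?orbT //; case: eqP jr inr => // -> ->.
  by rewrite memv_cap pU memv_ker fp ?mem_head // eqxx eqxx.
apply/dimvS/subvP => d dD.
have [|p pU fp] := onto (fun j => if j == i then d else 0).
  by move=> j _; case: eqP => [->|_]; rewrite ?mem0v.
have := fp i (mem_head _ _); rewrite eqxx => <-; exact: memv_img.
Qed.

Definition bollobas_pairs (K : fieldType) (V : vectType K) (T : finType)
    (A B : T -> {vspace V}) :=
  (forall i, (A i :&: B i)%VS = 0%VS) /\ (forall i j, i != j -> (A i :&: B j)%VS != 0%VS).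

(** The positions present in every monomial at stage [n]: the first [s], which carry the bases of
    B_i and A_i, and those from [n] on, since multiplying by a processed vector or taking its kernel
    leaves only multiples of it. *)
Definition frozen (s n : nat) : pred nat := fun l => ((l < s) || (n <= l))%N.

Lemma count_frozen s n N : (s <= n <= N)%N ->
  count (frozen s n) (iota 0 N) = (s + (N - n))%N.
Proof.
case/andP=> lesn lenN.
have -> : iota 0 N = iota 0 s ++ iota s (n - s) ++ iota n (N - n).
  have {1}-> : (N = s + ((n - s) + (N - n)))%N by lia.
  by rewrite !iotaD add0n subnKC.
rewrite !count_cat.
have /eqP -> : count (frozen s n) (iota 0 s) == size (iota 0 s).
  by rewrite -all_count; apply/allP => l; rewrite mem_iota /frozen; lia.
have /eqP -> : count (frozen s n) (iota n (N - n)) == size (iota n (N - n)).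
  by rewrite -all_count; apply/allP => l; rewrite mem_iota /frozen; lia.
have -> : count (frozen s n) (iota s (n - s)) = 0%N.
  apply/eqP; rewrite eqn0Ngt -has_count; apply/hasP => -[l].
  by rewrite mem_iota /frozen; lia.
by rewrite !size_iota.
Qed.

Section Frozen.
Variables (K : fieldType) (N : nat).
Implicit Types s n j : nat.

Lemma frozen_small s n j : (s <= n <= N)%N -> (j < s + (N - n))%N ->
  supp K (frozen s n) N j = 0%VS.
Proof.
move=> len ltj; apply/eqP; rewrite -dimv_eq0 dim_supp count_frozen //.
by rewrite leqNgt ltj.
Qed.

Lemma frozen_mul s n j : (s <= n < N)%N ->
  (evar K N n @: supp K (frozen s n.+1) N j)%VS = supp K (frozen s n) N j.+1.
Proof.
move=> /andP[lesn ltnN]; rewrite supp_mul //; last by rewrite /frozen; lia.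
by apply: eq_supp => l _; rewrite /= /frozen; lia.
Qed.

Lemma frozen_ker s n j p : (s <= n < N)%N -> p \in supp K (frozen s n.+1) N j ->
  evar K N n p = 0 -> p \in supp K (frozen s n) N j.
Proof.
move=> /andP[lesn ltnN] pS xp0.
rewrite (@eq_supp _ _ (predU1 n (frozen s n.+1))).
  by apply: supp_ker => //; rewrite /frozen; lia.
by move=> l _; rewrite /= /frozen; lia.
Qed.

End Frozen.

Section Core.
Variables (K : fieldType) (V : vectType K).
Hypothesis Kinf : infinite_field K.
Variables (T : finType) (A B : T -> {vspace V}).
Hypothesis AB : bollobas_pairs A B.

Let N := \dim {:V}.
Let a i := \dim (A i).
Let s i := (\dim (A i) + \dim (B i))%N.
Let XA i : seq V := vbasis (A i).
Let XB i : seq V := vbasis (B i).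

Lemma free_cat_vbasis i j : free (XB i ++ XA j) = (A j :&: B i == 0)%VS.
Proof.
rewrite cat_free !(basis_free (vbasisP _)) /=.
rewrite !(span_basis (vbasisP _)) capvC.
by apply/directv_addP/eqP.
Qed.

Let XBA i := XB i ++ XA i.

Lemma XBA_free i : free (XBA i).
Proof. by rewrite free_cat_vbasis AB.1. Qed.

Lemma size_XBA i : size (XBA i) = s i.
Proof. by rewrite size_cat !size_tuple addnC. Qed.

Lemma s_le i : (s i <= N)%N.
Proof.
rewrite -size_XBA; move: (XBA_free i); rewrite /free => /eqP <-.
exact/dimvS/subvf.
Qed.

(** Completing the bases of all pairs by tails of one [e] makes e_l a member of the basis of pair
    [i] whenever [s i <= l], so that each e_l can be processed for all pairs at once. *)
Lemma generic_frame : exists2 e : N.-tuple V, basis_of fullv e &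
  forall i, free (XBA i ++ drop (s i) e).
Proof.
have [es [szes esfree esX]] := generic_completion Kinf XBA_free (leqnn N).
have sz : size es == N by rewrite szes.
exists (Tuple sz) => /= [|i].
  by rewrite basisEfree esfree subvf /= szes.
by apply: esX; rewrite ?s_le // size_XBA subnKC ?s_le.
Qed.

Section WithFrame.
Variable e : N.-tuple V.
Hypothesis ebasis : basis_of fullv e.
Hypothesis efree : forall i, free (XBA i ++ drop (s i) e).

Let L := ext K N.
Let x l : 'End(L) := evar K N l.
Let u i := XBA i ++ drop (s i) e.
Let Phi i := frame e (u i).
Let G j := supp K pred0 N j.
Let pA i : 'End(L) := wprod e (XA i).
Let f i : 'End(L) := wprod e (XB i).

(** The offset [N - n] counts the processed vectors, each of which is a factor. *)
Definition stageX n k := supp K (frozen 0 n) N (k + (N - n)).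
(** For [a i <= k], the number [k - a i + s i] is k + dim B_i, the degree that f_i gives to elements
    of degree k. *)
Definition stageD i n k : {vspace L} :=
  if (a i <= k)%N then (Phi i @: supp K (frozen (s i) n) N (k - a i + s i + (N - n)))%VS
  else 0%VS.
Definition stageI k := (\sum_i if (a i <= k)%N then pA i @: G (k - a i) else 0)%VS.
Definition stageJ k := (stageI k :&: \bigcap_i lker (f i))%VS.

Lemma size_u i : size (u i) = N.
Proof. by rewrite size_cat size_XBA size_drop size_tuple subnKC ?s_le. Qed.

Lemma u_high i l : (s i <= l)%N -> (u i)`_l = e`_l.
Proof.
by move=> lesl; rewrite nth_cat size_XBA ltnNge lesl /= nth_drop subnKC.
Qed.

Lemma x_Phi i l p : (s i <= l < N)%N -> x l (Phi i p) = Phi i (x l p).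
Proof.
case/andP=> lesl ltlN; rewrite /x /Phi (evar_wop ebasis) -(u_high lesl).
by rewrite frame_evar ?size_u.
Qed.

Lemma stageD_last i k :
  stageD i N k = if (a i <= k)%N then (f i @: (pA i @: G (k - a i)))%VS else 0%VS.
Proof.
rewrite /stageD; case: ifP => // leak; rewrite subnn addn0.
have -> : (f i @: (pA i @: G (k - a i)) = wprod e (take (s i) (u i)) @: G (k - a i))%VS.
  rewrite -limg_comp; apply: eq_in_limg => p _.
  by rewrite comp_lfunE /u take_size_cat ?size_XBA // wprod_cat.
rewrite wprod_frame ?efree ?size_u ?s_le //.
by congr (_ @: _)%VS; apply: eq_supp => l ltl; rewrite /frozen; lia.
Qed.

Lemma f_x i l p : f i (x l p) = (-1) ^+ size (XB i) *: x l (f i p).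
Proof. by rewrite /x !(evar_wop ebasis) wprod_wop. Qed.

Lemma pA_x i l p : pA i (x l p) = (-1) ^+ size (XA i) *: x l (pA i p).
Proof. by rewrite /x !(evar_wop ebasis) wprod_wop. Qed.

(** A_j and B_i meet nontrivially, so their concatenated bases are dependent. *)
Lemma f_pA i j p : i != j -> f i (pA j p) = 0.
Proof.
move=> ij; rewrite -wprod_cat wprod_dep //.
by rewrite free_cat_vbasis; apply: AB.2; rewrite eq_sym.
Qed.

(** By [f_pA], each f_i sees only the i-th summand of I, so the values can be prescribed
    independently. *)
Lemma stageI_onto k q : (forall i, q i \in stageD i N k) ->
  exists2 p, p \in stageI k & forall i, f i p = q i.
Proof.
move=> qD.
have /fin_all_exists[y yP] : forall i, exists y,
    y \in (if (a i <= k)%N then pA i @: G (k - a i) else 0)%VS /\ f i y = q i.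
  move=> i; have := qD i; rewrite stageD_last; case: ifP => _.
    by case/memv_imgP => y yS ->; exists y.
  by rewrite memv0 => /eqP ->; exists 0; rewrite mem0v linear0.
exists (\sum_i y i); first by apply: memv_sumr => i _; have [] := yP i.
move=> i; rewrite linear_sum /= (bigD1 i) //= (yP i).2 big1 ?addr0 // => j ji.
have [+ _] := yP j; case: ifP => _; last by rewrite memv0 => /eqP ->; rewrite linear0.
by case/memv_imgP => p _ ->; rewrite f_pA // eq_sym.
Qed.

Lemma stageI_into k i : (f i @: stageI k <= stageD i N k)%VS.
Proof.
rewrite limg_sum; apply/subv_sumP => j _; rewrite stageD_last.
case: (eqVneq i j) => [->|ij]; first by case: ifP => // _; rewrite limg0.
case: ifP => _; last by rewrite limg0 sub0v.
apply/subvP => _ /memv_imgP[_ /memv_imgP[p _ ->] ->].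
by rewrite f_pA // mem0v.
Qed.

Lemma stageI_stable k l : (x l @: stageI k <= stageI k.+1)%VS.
Proof.
rewrite limg_sum; apply/subv_sumP => i _; apply: (sumv_sup i) => //.
have [leak|_] := leqP (a i) k; last by rewrite limg0 sub0v.
rewrite leqW //; apply/subvP => _ /memv_imgP[_ /memv_imgP[p pG ->] ->].
have sgn : (-1) ^+ size (XA i) != 0 :> K by rewrite signr_eq0.
have -> : x l (pA i p) = pA i ((-1) ^+ size (XA i) *: x l p).
  by rewrite linearZ /= pA_x scalerA -expr2 sqrr_sign scale1r.
rewrite memv_img // memvZ // subSn //.
by apply: (subvP (wedge_supp _ _ _)); apply: memv_img.
Qed.

(** At stage [s i] every position is forced: at most the top degree is left, which all vectors
    kill. *)
Lemma stageD_kill i k l q : (l < s i)%N -> q \in stageD i (s i) k -> x l q = 0.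
Proof.
move=> ltls; rewrite /stageD; case: ifP => _; last first.
  by rewrite memv0 => /eqP ->; rewrite linear0.
case/memv_imgP => p pS ->; apply/eqP; rewrite -memv0 /x (evar_wop ebasis).
apply: (@wop_span _ _ _ _ _ _ (u i)); last first.
  by rewrite (frame_full ebasis (efree i) (size_u i)) memvf.
move=> v /(nthP 0)[z ltz <-]; rewrite size_u in ltz.
rewrite memv0 /Phi -frame_evar ?size_u //; apply/eqP.
rewrite (supp_kill (F := frozen (s i) (s i)) (j := (k - a i + s i + (N - s i))%N)) ?linear0 //.
by rewrite /frozen; case: ltnP.
Qed.

Lemma stage_start : stage x stageX s f stageD N stageI stageJ.
Proof.
split.
- move=> k; rewrite /stageX subnn addn0.
  rewrite (@eq_supp _ _ pred0); last by move=> l ltl; rewrite /frozen /=; lia.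
  apply/subv_sumP => i _; case: ifP => leak; last exact: sub0v.
  apply: subv_trans (wprod_supp _ _ _) _.
  by rewrite size_tuple subnK.
- by move=> k l _; apply: stageI_stable.
- move=> k q qD; have [|p pI fp] := @stageI_onto k (fun i => if (s i < N)%N then q i else 0).
    by move=> i; case: ifP => [/qD //|_]; apply: mem0v.
  by exists p => // i lts; rewrite fp lts.
- by move=> k i _; apply: stageI_into.
- move=> k i l p leNs ltl pI.
  have sE : s i = N by apply/eqP; rewrite eqn_leq s_le.
  apply: (@stageD_kill i k); first by rewrite sE.
  by rewrite sE; apply: (subvP (stageI_into _ _)); apply: memv_img.
- move=> k; apply: capvS => //; apply/subv_sumP => l _; exact: stageI_stable.
Qed.

Lemma stage_result k :
  ((N - k) * \dim (stageI k) <= k.+1 * \dim (stageJ k.+1) + \sum_i stage_edges s a i N k)%N.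
Proof.
apply: (@stage_dim K L x N _ _ stageX _ _ _ T s a f (fun i => (-1) ^+ size (XB i)) _ _
  stageD _ _ _ _ N stageI stageJ k _ stage_start) => //.
- by move=> l p; apply: wedge_sq.
- by move=> l l' p; apply: wedgeC.
- move=> n j ltnN; rewrite /stageX frozen_mul ?ltnN // -addnS.
  by have -> : ((N - n.+1).+1 = N - n)%N by lia.
- move=> n j ltnN; apply/subvP => p; rewrite memv_cap memv_ker => /andP[pX /eqP xp0].
  have := frozen_ker (s := 0) ltnN pX xp0.
  by rewrite /stageX addSnnS; have -> : ((N - n.+1).+1 = N - n)%N by lia.
- move=> n ltnN; apply/eqP; rewrite -subv0; apply/subvP => p.
  rewrite memv_cap memv_ker => /andP[pX /eqP xp0].
  have := frozen_ker (s := 0) ltnN pX xp0.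
  by rewrite frozen_small //; lia.
- by move=> i; rewrite signr_eq0.
- exact: f_x.
- move=> i n j /andP[lesn ltnN]; rewrite /stageD; case: ifP => leaj; last by rewrite dimv0.
  rewrite dim_frame ?efree ?size_u // dim_supp count_frozen; last by rewrite lesn ltnW.
  case: ifP => // _; have -> : (N - (s i + (N - n)) = n - s i)%N by lia.
  by have -> : (j - a i + s i + (N - n) - (s i + (N - n)) = j - a i)%N by lia.
- move=> i n j /andP[lesn ltnN]; rewrite /stageD; case: ifP => leaj; last exact: limg0.
  have -> : (N - n = (N - n.+1).+1)%N by lia.
  rewrite addnS -frozen_mul ?lesn // -!limg_comp.
  by apply: eq_in_limg => p _; rewrite !comp_lfunE x_Phi ?lesn.
- move=> i n j /andP[lesn ltnN]; rewrite /stageD; apply/subvP => p.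
  rewrite memv_cap memv_ker; case: ifP => leaj; last first.
    by rewrite memv0 => /andP[/eqP -> _]; apply: mem0v.
  case/andP => /memv_imgP[q qS ->]; rewrite x_Phi ?lesn // => /eqP xq0.
  have {}xq0 : x n q = 0.
    by apply: (frame_inj ebasis (efree i) (size_u i)); rewrite linear0.
  have := frozen_ker _ qS xq0; rewrite lesn => /(_ ltnN) qS'.
  have [leaj'|ltja] := leqP (a i) j.
    rewrite memv_img //; congr (_ \in supp _ _ _ _): qS'; lia.
  (* Here [a i = j.+1]: the degree is one below the number of forced positions, so q = 0. *)
  move: qS'; rewrite frozen_small ?lesn ?(ltnW ltnN) //; last by lia.
  by rewrite memv0 => /eqP ->; rewrite linear0 mem0v.
- move=> i j l q; exact: stageD_kill.
Qed.

(** The f_i together map I onto the direct sum of the [stageD i N k], with kernel J. *)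
Lemma dim_stageI k :
  (\sum_i (if a i <= k then 'C(N - s i, k - a i) else 0) + \dim (stageJ k)
    <= \dim (stageI k))%N.
Proof.
apply: leq_trans (@leq_sum_dimv_onto _ _ _ _ (index_enum T) f (fun i => stageD i N k) _ _ _).
- rewrite leq_add2r; apply: leq_sum => i _; rewrite /stageD; case: ifP => // leak.
  rewrite dim_frame ?efree ?size_u // dim_supp count_frozen ?s_le ?leqnn //.
  by rewrite subnn !addn0 leq_addl addnK.
- exact: index_enum_uniq.
- move=> q qD; have [|p pI fp] := @stageI_onto k q.
    by move=> i; apply: qD; rewrite mem_index_enum.
  by exists p.
Qed.

Lemma dim_stageJ_last : (\dim (stageJ N) <= 1)%N.
Proof.
apply: leq_trans (dimvS (capvSl _ _)) _.
apply: leq_trans (dimvS (stage_sub stage_start N)) _.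
rewrite dim_supp count_frozen ?leqnn // subnn addn0.
by rewrite leq0n addn0 subn0 binn.
Qed.

End WithFrame.

(* [h k] is the dimension of the degree k part of the ideal J of the header. *)
Lemma flow : exists h : nat -> nat, (h N <= 1)%N /\ forall k,
  ((N - k) * (\sum_i (if a i <= k then 'C(N - s i, k - a i) else 0) + h k)
   <= k.+1 * h k.+1 + \sum_i stage_edges s a i N k)%N.
Proof.
have [e ebasis efree] := generic_frame.
exists (fun k => \dim (stageJ e k)); split; first exact: dim_stageJ_last.
move=> k; apply: leq_trans (stage_result ebasis efree k).
by rewrite leq_mul2l dim_stageI ?orbT.
Qed.

End Core.

(** * The weighted inequality for subspaces *)

Section Weights.
Variable R : realFieldType.

(* The inverse of the number (N - k) * 'C(N, k) of covering relations between the levels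
   k and k + 1 of the Boolean lattice of rank N. *)
Definition chain_weight (N k : nat) : R := ((N - k)%:R * 'C(N, k)%:R)^-1.
Definition interval_bin (r a k : nat) : nat := if (a <= k)%N then 'C(r, k - a) else 0%N.

(** In terms of 'C(N, k), the left side is (1 + (k+1)/(N-k)) / ((N+1) 'C(N, k)). *)
Lemma chain_weightS N k : (k < N)%N ->
  chain_weight N.+1 k + chain_weight N.+1 k.+1 = chain_weight N k.
Proof.
move=> ltkN; rewrite /chain_weight subSS.
have E1 : ((N.+1 - k) * 'C(N.+1, k) = N.+1 * 'C(N, k))%N by rewrite mul_bin_down.
have E2 : (k.+1 * 'C(N.+1, k.+1) = N.+1 * 'C(N, k))%N by rewrite -mul_bin_diag.
have c0 : 'C(N, k)%:R != 0 :> R by rewrite pnatr_eq0 -lt0n bin_gt0 ltnW.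
have nk0 : (N - k)%:R != 0 :> R by rewrite pnatr_eq0; lia.
have k0 : k.+1%:R != 0 :> R by rewrite pnatr_eq0.
have n0 : N.+1%:R != 0 :> R by rewrite pnatr_eq0.
rewrite -natrM E1.
have -> : 'C(N.+1, k.+1)%:R = N.+1%:R * 'C(N, k)%:R / k.+1%:R :> R.
  by rewrite -natrM -E2 natrM mulrAC mulfV // mul1r.
have EN : N.+1%:R = (N - k)%:R + k.+1%:R :> R by rewrite -natrD; congr _%:R; lia.
rewrite natrM EN; rewrite EN in n0; field.
by rewrite c0 nk0 nat1r k0 n0.
Qed.

Lemma interval_binS r a k :
  interval_bin r.+1 a k
  = (interval_bin r a k + (if k is k'.+1 then interval_bin r a k' else 0))%N.
Proof.
rewrite /interval_bin; case: k => [|k].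
  by rewrite addn0; case: a => //= ; rewrite !bin0.
have [leak|ltka] := leqP a k; first by rewrite leqW // subSn // binS.
case: ifP => // leak; have -> : (k.+1 - a = 0)%N by lia.
by rewrite !bin0.
Qed.

(** The probability that a random maximal chain meets an interval, counted where the chain leaves
    it: each set of the interval has [b] upper covers outside, and b > 0 makes every such chain
    leave. Pascal's rule and [chain_weightS] reduce the rank to a + b. *)
Lemma sum_chain_weight a b N : (0 < b)%N -> (a + b <= N)%N ->
  \sum_(k < N) (b * interval_bin (N - (a + b)) a k)%:R * chain_weight N k
  = 'C(a + b, a)%:R^-1.
Proof.
move=> b0 leN; have -> : (N = (a + b) + (N - (a + b)))%N by lia.
move: (N - (a + b))%N => r {N leN}; rewrite addKn.
elim: r => [|r IH].
  rewrite addn0; have lta : (a < a + b)%N by lia.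
  rewrite (bigD1 (Ordinal lta)) //= big1 ?addr0 => [|k].
    rewrite /interval_bin leqnn subnn bin0 muln1 /chain_weight addKn.
    by rewrite invfM mulrA mulfV ?mul1r // pnatr_eq0 -lt0n.
  rewrite -val_eqE /= => ka; rewrite /interval_bin; case: leqP => leak.
    by rewrite bin0n subn_eq0 leqNgt ltn_neqAle eq_sym ka leak muln0 mul0r.
  by rewrite muln0 mul0r.
rewrite -IH addnS; set N := (a + b + r)%N.
under eq_bigr => k _ do rewrite interval_binS mulnDr natrD mulrDl.
rewrite big_split /= big_ord_recr /= [X in _ + X]big_ord_recl /=.
rewrite muln0 mul0r add0r {2}/interval_bin bin_small; last by rewrite /N; lia.
rewrite if_same muln0 mul0r addr0 -big_split; apply: eq_bigr => k _ /=.
by rewrite -mulrDr chain_weightS.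
Qed.

(** Cancelling in [flow] the relations inside the intervals leaves those that exit them, bounded by
    the growth of the density [H] of J; the increments telescope to at most 1. *)
Theorem weighted_bollobas (K : fieldType) (V : vectType K) (T : finType)
    (A B : T -> {vspace V}) :
  infinite_field K -> (forall i, 0 < \dim (B i))%N -> bollobas_pairs A B ->
  \sum_i ('C(\dim (A i) + \dim (B i), \dim (A i))%:R)^-1 <= 1 :> R.
Proof.
move=> Kinf B0 AB; have [h [hN flowh]] := flow Kinf AB.
set N := \dim {:V} in hN flowh.
pose a i := \dim (A i); pose b i := \dim (B i).
have sN i : (a i + b i <= N)%N by apply: s_le.
pose H k : R := (h k)%:R / 'C(N, k)%:R.
have step k : (k < N)%N ->
  \sum_i (b i * interval_bin (N - (a i + b i)) (a i) k)%:R * chain_weight N k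
  <= H k.+1 - H k.
  move=> ltkN; rewrite -mulr_suml -natr_sum.
  have c0 : 0 < 'C(N, k)%:R :> R by rewrite ltr0n bin_gt0 ltnW.
  have nk0 : 0 < (N - k)%:R :> R by rewrite ltr0n; lia.
  (* Of the N - k upper covers of a good set at level k, b_i leave its interval and the others
     stay. *)
  have E : ((N - k) * (\sum_i interval_bin (N - (a i + b i)) (a i) k)
    = \sum_i b i * interval_bin (N - (a i + b i)) (a i) k
      + \sum_i stage_edges (fun i => a i + b i) a i N k)%N.
    rewrite big_distrr -big_split; apply: eq_bigr => i _ /=.
    rewrite /interval_bin /stage_edges; case: ifP => leak; last by rewrite !muln0.
    have := sN i; move: leak; move: (a i) (b i) => ai bi leak leN.
    have [lek|ltk] := leqP (k - ai) (N - (ai + bi)); last first.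
      rewrite !bin_small ?muln0 //; lia.
    have E' : (N - k = (N - (ai + bi) - (k - ai)) + bi)%N by lia.
    rewrite {1}E' mulnDl addnC; congr addn.
    case: (N - (ai + bi))%N lek => [|r] lek; first by rewrite !mul0n.
    by rewrite mul_bin_down.
  have hk : ((N - k) * \sum_i interval_bin (N - (a i + b i)) (a i) k + (N - k) * h k
     <= k.+1 * h k.+1 + \sum_i stage_edges (fun i => a i + b i) a i N k)%N.
    by rewrite -mulnDr; apply: flowh.
  rewrite E addnAC leq_add2r in hk.
  have -> : H k.+1 - H k = ((k.+1 * h k.+1)%:R - ((N - k) * h k)%:R) * chain_weight N k.
    rewrite /H /chain_weight mulrBl; congr (_ - _); last first.
      by rewrite natrM; field; rewrite !lt0r_neq0.
    rewrite -natrM -mul_bin_left !natrM; field.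
    by rewrite nat1r !pnatr_eq0 -lt0n bin_gt0 ltkN.
  apply: ler_wpM2r; first by rewrite invr_ge0 mulr_ge0 ?ler0n.
  by rewrite lerBrDr -natrD ler_nat.
have -> : \sum_i ('C(\dim (A i) + \dim (B i), \dim (A i))%:R)^-1
   = \sum_(k < N) \sum_i (b i * interval_bin (N - (a i + b i)) (a i) k)%:R * chain_weight N k :> R.
  by rewrite exchange_big; apply: eq_bigr => i _; rewrite sum_chain_weight //; apply: B0.
apply: (@le_trans _ _ (\sum_(k < N) (H k.+1 - H k))).
  by apply: ler_sum => k _; apply: step.
rewrite -(big_mkord xpredT (fun k => H k.+1 - H k)) telescope_sumr //.
have H0 : 0 <= H 0%N by rewrite divr_ge0 ?ler0n.
have HN : H N <= 1 by rewrite /H binn divr1 -[1]/(1%:R) ler_nat.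
by lra.
Qed.

End Weights.

(** * Gap and threshold *)

Section CoordinateSubspaces.
Variables (K : fieldType) (V : vectType K) (n : nat) (X : n.-tuple V).
Hypothesis Xfree : free X.

Definition spanI (S : {set 'I_n}) : {vspace V} := (\sum_(i in S) <[X`_i]>)%VS.

Lemma mem_spanI (S : {set 'I_n}) i : i \in S -> X`_i \in spanI S.
Proof. by move=> iS; rewrite memvE; apply: (sumv_sup i). Qed.

Lemma spanI_subv (S : {set 'I_n}) (U : {vspace V}) :
  (forall i, i \in S -> X`_i \in U) -> (spanI S <= U)%VS.
Proof. by move=> SU; apply/subv_sumP => i iS; rewrite -memvE SU. Qed.

Lemma spanIS (S S' : {set 'I_n}) : S \subset S' -> (spanI S <= spanI S')%VS.
Proof. by move/subsetP => sub; apply: spanI_subv => i /sub; apply: mem_spanI. Qed.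

Lemma spanI_setU S S' : spanI (S :|: S') = (spanI S + spanI S')%VS.
Proof.
apply/eqP; rewrite eqEsubv subv_add !spanIS ?subsetUl ?subsetUr //.
rewrite !andbT; apply: spanI_subv => i; rewrite inE => /orP[] iS.
  by apply: (subvP (addvSl _ _)); apply: mem_spanI.
by apply: (subvP (addvSr _ _)); apply: mem_spanI.
Qed.

Lemma spanI_setT : spanI setT = <<X>>%VS.
Proof.
apply/eqP; rewrite eqEsubv; apply/andP; split.
  by apply: spanI_subv => i _; rewrite memv_span // mem_nth ?size_tuple.
apply/span_subvP => v /(nthP 0)[i]; rewrite size_tuple => ltin <-.
exact: (@mem_spanI setT (Ordinal ltin)).
Qed.

(** The upper bounds for S and its complement add up to the dimension n of the whole span, so both
    are attained. *)
Lemma dim_spanI S : \dim (spanI S) = #|S|.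
Proof.
have le S' : (\dim (spanI S') <= #|S'|)%N.
  apply: leq_trans (dimv_leq_sum _ _ _) _; rewrite -sum1_card.
  by apply: leq_sum => i _; rewrite dim_vline; case: eqP.
have := le S; have := le (~: S); have := dimv_sum_cap (spanI S) (spanI (~: S)).
rewrite -spanI_setU setUCr spanI_setT; move: Xfree; rewrite /free size_tuple => /eqP ->.
have := cardsC S; rewrite card_ord; lia.
Qed.

Lemma dim_spanI_cap S S' : \dim (spanI S :&: spanI S') = #|S :&: S'|.
Proof.
have := dimv_sum_cap (spanI S) (spanI S'); rewrite -spanI_setU !dim_spanI.
have := cardsUI S S'; lia.
Qed.

End CoordinateSubspaces.

(** * Generic hyperplanes *)

Section Hyperplanes.
Variables (K : fieldType) (V : vectType K).
Hypothesis Kinf : infinite_field K.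

(** H grows by one vector w at a time; taking w outside H and every H + <v> keeps each v of [xs] out
    of H + <w>. *)
Lemma avoiding_hyperplane (xs : seq V) r : 0 \notin xs -> (r < \dim {:V})%N ->
  exists2 H : {vspace V}, \dim H = r & all (fun v => v \notin H) xs.
Proof.
move=> xs0; elim: r => [|r IH] ltr.
  exists 0%VS; rewrite ?dimv0 //; apply/allP => v vxs; rewrite memv0.
  by apply: contraNneq xs0 => <-.
have [H dH /allP xsH] := IH (ltnW ltr).
have [|w] := avoid_subspaces Kinf (Us := H :: [seq (H + <[v]>)%VS | v <- xs]).
  have ne (U : {vspace V}) : (\dim U <= r.+1)%N -> U != fullv.
    by move=> leU; apply: contraTneq ltr => <-; rewrite -leqNgt.
  rewrite /= ne ?dH //; apply/allP => _ /mapP[v _ ->]; apply: ne.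
  apply: leq_trans (dimv_add_leqif _ _).1 _; rewrite dH dim_vline -addn1 leq_add2l.
  by case: eqP.
case/andP=> wH /allP wxs; exists (H + <[w]>)%VS.
  rewrite dimv_disjoint_sum ?dH ?dim_vline.
    by rewrite (_ : w != 0) ?addn1 //; apply: contraNneq wH => ->; rewrite mem0v.
  apply/eqP; rewrite -subv0; apply/subvP => z; rewrite memv_cap => /andP[zH /vlineP[k zE]].
  have [k0|k0] := eqVneq k 0; first by rewrite zE k0 scale0r mem0v.
  by case/negP: wH; rewrite -(scalerK k0 w) -zE memvZ.
apply/allP => v vxs; apply/negP => /memv_addP[h hH [_ /vlineP[k ->] vE]].
have [k0|k0] := eqVneq k 0.
  by have /negP := xsH v vxs; rewrite vE k0 scale0r addr0.
have /negP := wxs _ (map_f (fun v => H + <[v]>)%VS vxs); apply.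
have -> : w = k^-1 *: (v - h) by rewrite vE addrC addKr scalerK.
by rewrite memvZ // addrC memv_add ?memvN // memv_line.
Qed.

(** A hyperplane avoiding one nonzero vector of each nonzero member of [Us] cuts these members
    properly. *)
Lemma cutting_hyperplane (Us : seq {vspace V}) : (0 < \dim {:V})%N ->
  exists2 H : {vspace V}, (forall U : {vspace V}, \dim U <= \dim (U :&: H) + 1)%N &
    {in Us, forall U : {vspace V}, U != 0%VS -> \dim (U :&: H) = (\dim U).-1}.
Proof.
move=> V0.
have [||H dH /allP UsH] := @avoiding_hyperplane
    [seq vpick U | U <- Us & U != 0%VS] (\dim {:V}).-1.
- by apply/mapP => -[U]; rewrite mem_filter -vpick0 => /andP[/negPf U0 _] /esym/eqP; rewrite U0.
- by rewrite prednK.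
have cut U : (\dim U <= \dim (U :&: H) + 1)%N.
  by have := dimv_sum_cap U H; have := dimvS (subvf (U + H)%VS); rewrite dH; lia.
exists H => // U UUs U0; have := cut U.
have : (\dim (U :&: H) < \dim U)%N.
  rewrite ltn_neqAle dimvS ?capvSl // andbT; apply/negP => /eqP dE.
  have /eqP UH : (U :&: H)%VS == U by rewrite eqEdim capvSl dE /=.
  have /negP : vpick U \notin H.
    by apply/UsH/(map_f (fun U : {vspace V} => vpick U)); rewrite mem_filter U0.
  apply.
  by apply: (subvP (capvSr U H)); rewrite UH memv_pick.
lia.
Qed.

End Hyperplanes.

(** Both sides equal (a+b)! / (a! s! (b-s)!). *)
Lemma bin_gap a b s : (s <= b)%N ->
  ('C(b, s) * 'C(a + b, a) = 'C(a + s, s) * 'C(a + b, a + s))%N.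
Proof.
move=> lesb; apply/eqP; rewrite -(eqn_pmul2r (fact_gt0 a)) -(eqn_pmul2r (fact_gt0 s)).
rewrite -(eqn_pmul2r (fact_gt0 (b - s))); apply/eqP.
have E1 := bin_fact lesb.
have E2 := bin_fact (leq_addr b a); rewrite addKn in E2.
have E3 := bin_fact (leq_addl a s); rewrite addnK in E3.
have le : (a + s <= a + b)%N by rewrite leq_add2l.
have E4 := bin_fact le; rewrite subnDl in E4.
transitivity ((a + b)`!)%N.
  by rewrite -E2 -E1; ring.
by rewrite -E4 -E3; ring.
Qed.

Section Gap.
Variables (R : realFieldType) (K : fieldType) (V : vectType K).
Hypothesis Kinf : infinite_field K.
Variables (T : finType) (s : nat).

(* Split a basis of B i in all ways into s vectors, moved to the side of A i, and the
   remaining ones; the resulting pairs still cross, and the bound without gap applies to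
   them. *)
Theorem gap_bollobas (A B : T -> {vspace V}) :
  (forall i, (A i :&: B i)%VS = 0%VS) ->
  (forall i j, i != j -> s < \dim (A i :&: B j))%N ->
  (forall i, s < \dim (B i))%N ->
  \sum_i 'C(\dim (A i) + s, s)%:R / 'C(\dim (A i) + \dim (B i), \dim (A i))%:R <= 1 :> R.
Proof.
move=> AB0 ABs Bs.
pose Y i : (\dim (B i)).-tuple V := vbasis (B i).
have Yfree i : free (Y i) := basis_free (vbasisP (B i)).
have YB i (S : {set 'I_(\dim (B i))}) : (spanI (Y i) S <= B i)%VS.
  by apply: spanI_subv => l _; rewrite vbasis_mem // mem_nth ?size_tuple.
pose I := {i : T & {set 'I_(\dim (B i))}}.
pose mk i S : I := @Tagged T i (fun i => {set 'I_(\dim (B i))}) S.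
pose P (x : I) := #|tagged x| == s.
pose A' (x : I) := (A (tag x) + spanI (Y (tag x)) (tagged x))%VS.
pose B' (x : I) := spanI (Y (tag x)) (~: tagged x).
have dA' x : P x -> \dim (A' x) = (\dim (A (tag x)) + s)%N.
  move/eqP => cx; rewrite /A' dimv_disjoint_sum ?dim_spanI ?cx //.
  by apply/eqP; rewrite -subv0 -(AB0 (tag x)); apply: capvS.
have dB' x : P x -> \dim (B' x) = (\dim (B (tag x)) - s)%N.
  by move/eqP => cx; rewrite dim_spanI // cardsCs setCK card_ord cx.
have pairs : bollobas_pairs (fun x : {x in P} => A' (val x)) (fun x => B' (val x)).
  split=> [[x Px]|[x Px] [y Py]] /=.
    apply/eqP; rewrite -dimv_eq0; have := dimv_sum_cap (A' x) (B' x).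
    have -> : (A' x + B' x = A (tag x) + B (tag x))%VS.
      rewrite -addvA -spanI_setU setUCr spanI_setT.
      by rewrite (span_basis (vbasisP _)).
    rewrite dimv_disjoint_sum ?AB0 // dA' // dB' //.
    have aux d1 d2 d3 : (d1 + d2 + d3 = d1 + s + (d2 - s) -> s < d2 -> d3 == 0)%N by lia.
    by move/aux; apply; apply: Bs.
  rewrite -val_eqE /= => xy; have [Etag|ij] := eqVneq (tag x) (tag y).
    case: x y Px Py xy Etag => i S [j S'] /= Px Py + Eij; case: j / Eij S' Py => S' Py.
    rewrite eq_Tagged /= => SS'.
    (* Same pair, different sets of equal size: some basis vector is moved for S but kept for S'. *)
    have [l lS lS'] : exists2 l, l \in S & l \notin S'.
      apply/subsetPn; apply: contraNN SS' => sub.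
      by rewrite eqEcard sub (eqP Px) (eqP Py) /=.
    have lA : (Y i)`_l \in A' (mk i S).
      by apply: (subvP (addvSr _ _)); apply: mem_spanI.
    have lB : (Y i)`_l \in B' (mk i S') by apply: mem_spanI; rewrite inE.
    apply/eqP => AB; have : (Y i)`_l != 0.
      by apply: (free_not0 (Yfree i)); rewrite mem_nth ?size_tuple.
    by rewrite -memv0 -AB memv_cap lA lB.
  (* Different pairs: B' has codimension [s] in B_j, while A_i cap B_j has dimension above [s]. *)
  have : (0 < \dim (A (tag x) :&: B' y))%N.
    have aux d1 d2 d3 d4 : (d3 + d4 = d1 + (d2 - s) -> d3 <= d2 -> s < d1 -> s < d2 -> 0 < d4)%N.
      by lia.
    have E := dimv_sum_cap (A (tag x) :&: B (tag y)) (B' y).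
    rewrite -capvA (capv_idPr (YB _ _)) dB' // in E.
    apply: aux E _ (ABs _ _ ij) (Bs _).
    by apply: dimvS; rewrite subv_add capvSr YB.
  rewrite lt0n dimv_eq0; apply: contraNneq => AB; rewrite -subv0 -AB.
  by apply: capvS => //; apply: addvSl.
have := @weighted_bollobas R K V _ _ _ Kinf _ pairs.
rewrite -(big_sub P (fun x => ('C(\dim (A' x) + \dim (B' x), \dim (A' x))%:R)^-1)).
move=> le1; apply: le_trans (le1 _) => [|[x Px] /=]; last first.
  by rewrite dB' // subn_gt0.
rewrite (eq_bigl (fun x : I => xpredT (tag x) && (#|tagged x| == s))) //.
rewrite -(sig_big_dep xpredT (fun i (S : {set 'I_(\dim (B i))}) => #|S| == s)
  (fun i S => ('C(\dim (A' (mk i S)) + \dim (B' (mk i S)), \dim (A' (mk i S)))%:R)^-1)) /=.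
apply: ler_sum => i _.
(* All splittings of pair i contribute the same term; there are 'C(dim B_i, s) of them, and
   [bin_gap] gives the stated quotient. *)
rewrite (eq_bigr (fun=> ('C(\dim (A i) + \dim (B i), \dim (A i) + s)%:R)^-1)); last first.
  move=> S cS; rewrite dA' // dB' //= -addnA subnKC //; exact: ltnW.
rewrite sumr_const -cardsE card_draws card_ord -[leRHS]mulr_natl.
have lesb : (s <= \dim (B i))%N by apply: ltnW.
have c1 : 'C(\dim (A i) + \dim (B i), \dim (A i))%:R != 0 :> R.
  by rewrite pnatr_eq0 -lt0n bin_gt0 leq_addr.
have c2 : 'C(\dim (A i) + \dim (B i), \dim (A i) + s)%:R != 0 :> R.
  by rewrite pnatr_eq0 -lt0n bin_gt0 leq_add2l.
have /(congr1 (fun z => z%:R : R)) := bin_gap (\dim (A i)) lesb; rewrite !natrM => E.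
by rewrite le_eqVlt; apply/orP; left; rewrite eqr_div // E.
Qed.
End Gap.

(** The numerators, which depend on [a] alone, are kept because the equality case is read off from
    them. *)
Definition threshold_sum (R : realFieldType) (t s : nat) (T : finType) (a b : T -> nat) : R :=
  \sum_i 'C(a i - t + s, s)%:R / 'C(a i + b i - 2 * t, a i - t)%:R.

(** The sizes are required separately: crossing implies them only when T has at least two
    elements. *)
Definition threshold_pairs (K : fieldType) (V : vectType K) (t s : nat) (T : finType)
    (A B : T -> {vspace V}) :=
  [/\ forall i, (\dim (A i :&: B i) <= t)%N,
      forall i j, i != j -> (t + s < \dim (A i :&: B j))%N &
      forall i, (t + s < \dim (A i))%N && (t + s < \dim (B i))%N].

(** Induction on [t]: a generic hyperplane lowers each dim A_i, dim B_i and nonzero dim (A_i cap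
    B_i) by one and the crossing dimensions by at most one, so the sum for [t.+1] becomes the same
    sum for [t]. *)
Theorem threshold_bollobas_infinite (R : realFieldType) (K : fieldType) (V : vectType K)
    (t s : nat) (T : finType) (A B : T -> {vspace V}) :
  infinite_field K -> threshold_pairs t s A B ->
  threshold_sum R t s (fun i => \dim (A i)) (fun i => \dim (B i)) <= 1.
Proof.
move=> Kinf; elim: t A B => [|t IH] A B [AB0 ABs ABd].
  rewrite /threshold_sum; under eq_bigr => i _ do rewrite muln0 !subn0.
  apply: gap_bollobas => // i; last by case/andP: (ABd i).
  by apply/eqP; rewrite -dimv_eq0 -leqn0.
(* Members of a pair are nonzero, so V = 0 leaves no pair at all. *)
have [V0|] := posnP (\dim {:V}).
  rewrite /threshold_sum big1 // => i _; have /andP[] := ABd i.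
  by have := dimvS (subvf (A i)); rewrite V0; lia.
move=> V0; have [H cut cutE] := cutting_hyperplane Kinf
  (codom A ++ codom B ++ codom (fun i => A i :&: B i)%VS) V0.
have dA i : \dim (A i :&: H) = (\dim (A i)).-1.
  apply: cutE; first by rewrite !mem_cat codom_f.
  by rewrite -dimv_eq0 -lt0n; have /andP[] := ABd i; lia.
have dB i : \dim (B i :&: H) = (\dim (B i)).-1.
  apply: cutE; first by rewrite !mem_cat codom_f orbT.
  by rewrite -dimv_eq0 -lt0n; have /andP[] := ABd i; lia.
have capH i j : ((A i :&: H) :&: (B j :&: H) = (A i :&: B j) :&: H)%VS.
  by rewrite -capvA [(H :&: _)%VS]capvC -[(B j :&: H :&: H)%VS]capvA capvv capvA.
have pairs : threshold_pairs t s (fun i => A i :&: H)%VS (fun i => B i :&: H)%VS.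
  split=> [i|i j ij|i].
  - rewrite capH; have [-> | AB] := eqVneq (A i :&: B i)%VS 0%VS.
      by rewrite cap0v dimv0.
    rewrite cutE //; first by have := AB0 i; lia.
    by rewrite !mem_cat (codom_f (fun i => A i :&: B i)%VS) !orbT.
  - by rewrite capH; have := cut (A i :&: B j)%VS; have := ABs i j ij; lia.
  - by rewrite dA dB; have /andP[] := ABd i; lia.
have := IH _ _ pairs; rewrite /threshold_sum; congr (_ <= 1).
apply: eq_bigr => i _; rewrite dA dB; have /andP[ltA ltB] := ABd i.
have -> : ((\dim (A i)).-1 - t = \dim (A i) - t.+1)%N by lia.
by have -> : ((\dim (A i)).-1 + (\dim (B i)).-1 - 2 * t
  = \dim (A i) + \dim (B i) - 2 * t.+1)%N by lia.
Qed.

Lemma ratfun_infinite (F : fieldType) : infinite_field {fraction {poly F}}.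
Proof.
move=> r; pose p_ n := tofrac ('X^n : {poly F}).
have p_inj : injective p_.
  move=> n n' /eqP; rewrite tofrac_eq => /eqP/(congr1 (fun p : {poly F} => size p)).
  by rewrite !size_polyXn => -[].
have [/allP sub|/allPn[c _ cr]] := boolP (all (mem r) (mkseq p_ (size r).+1)); last by exists c.
have /uniq_leq_size/(_ sub) : uniq (mkseq p_ (size r).+1) by rewrite mkseq_uniq.
by rewrite size_mkseq ltnn.
Qed.

(** * Extension of scalars *)

Section ScalarExtension.
Import VectorInternalTheory.
Variables (F K : fieldType) (phi : {rmorphism F -> K}) (V : vectType F).

Let W : vectType K := 'rV[K]_(dim V).
Let P : 'M[K]_(dim V, dim W) := lin1_mx v2r.

(** The coordinate matrix of A read over [K]; [P] converts row vectors into the internal coordinates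
    of [W]. *)
Definition ext_scalars (A : {vspace V}) : {vspace W} := mx2vs (map_mx phi (vs2mx A) *m P).

Lemma v2r_row_free : row_free P.
Proof.
apply/row_freeP; exists (lin1_mx r2v); apply/row_matrixP => i.
by rewrite rowE mulmxA mul_rV_lin1 mul_rV_lin1 /= v2rK row1 .
Qed.

Lemma rank_mx2vs m (M : 'M[K]_(m, dim W)) : \dim (mx2vs M) = \rank M.
Proof. by rewrite /dimv mx2vsK. Qed.

Lemma dim_ext_scalars A : \dim (ext_scalars A) = \dim A.
Proof. by rewrite rank_mx2vs mxrankMfree ?v2r_row_free // mxrank_map. Qed.

Lemma dim_ext_scalars_add A B : \dim (ext_scalars A + ext_scalars B) = \dim (A + B).
Proof.
rewrite {1}/addv rank_mx2vs (adds_eqmx (mx2vsK _) (mx2vsK _)) -addsmxMr.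
rewrite mxrankMfree ?v2r_row_free // -map_addsmx mxrank_map.
by rewrite /dimv /addv mx2vsK.
Qed.

(** Dimensions of sums are preserved because ranks are; intersections follow by the dimension
    formula. *)
Lemma dim_ext_scalars_cap A B : \dim (ext_scalars A :&: ext_scalars B) = \dim (A :&: B).
Proof.
have := dimv_sum_cap (ext_scalars A) (ext_scalars B); have := dimv_sum_cap A B.
rewrite dim_ext_scalars_add !dim_ext_scalars; lia.
Qed.

End ScalarExtension.

Theorem threshold_bollobas (R : realFieldType) (F : fieldType) (V : vectType F)
    (t s : nat) (T : finType) (A B : T -> {vspace V}) :
  threshold_pairs t s A B ->
  threshold_sum R t s (fun i => \dim (A i)) (fun i => \dim (B i)) <= 1.
Proof.
move=> [AB0 ABs ABd].
pose phi : {rmorphism F -> {fraction {poly F}}} := (@tofrac {poly F}) \o polyC.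
have := @threshold_bollobas_infinite R _ _ t s T (fun i => ext_scalars phi (A i))
  (fun i => ext_scalars phi (B i)) (@ratfun_infinite F).
rewrite /threshold_sum; under eq_bigr => i _ do rewrite !dim_ext_scalars; apply.
split=> [i|i j ij|i]; rewrite ?dim_ext_scalars_cap ?dim_ext_scalars //; exact: ABs.
Qed.

(** * Extremal systems *)

Lemma bin_double s : 'C(2 * s + 2, s + 1) = (2 * 'C(2 * s + 1, s))%N.
Proof.
have -> : (2 * s + 2 = (2 * s + 1).+1)%N by lia.
rewrite (addn1 s) binS [RHS]mul2n -addnn; congr addn.
by rewrite -bin_sub; [congr 'C(_, _); lia | lia].
Qed.

Lemma bollobas_boundE (R : realFieldType) s :
  bollobas_bound R s = ('C(2 * s + 1, s)%:R)^-1.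
Proof.
by rewrite /bollobas_bound bin_double natrM invfM mulrA mulfV ?mul1r // pnatr_eq0.
Qed.

(** At s = 0 both sides would be 1; this is where the equality case uses s >= 1. *)
Lemma ltn_bin2l s n n' : (0 < s <= n)%N -> (n < n')%N -> ('C(n, s) < 'C(n', s))%N.
Proof.
case/andP; case: s => // s _ lesn ltnn'.
apply: (@leq_trans 'C(n.+1, s.+1)); last exact: leq_bin2l.
by rewrite binS -[ltnLHS]addn0 ltn_add2l bin_gt0 ltnW.
Qed.

Section Numerics.
Variables (R : realFieldType) (t s m : nat).
Implicit Types a b : 'I_m -> nat.

Lemma bollobas_sumC a b :
  (forall i, (t <= a i)%N && (t <= b i)%N) -> bollobas_sum R t a b = bollobas_sum R t b a.
Proof.
move=> ab; apply: eq_bigr => i _; have /andP[ta tb] := ab i.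
rewrite [in RHS]addnC -bin_sub; last by lia.
by congr (_%:R^-1); congr 'C(_, _); lia.
Qed.

(** The numerators exceed c = 'C(2s+1, s) by nonnegative amounts; if the bound is attained, all
    these excesses vanish, which fixes each a_i. *)
Lemma bollobas_sum_le a b :
  (forall i, t + s < a i)%N -> (forall i, t <= b i)%N -> threshold_sum R t s a b <= 1 ->
  bollobas_sum R t a b <= bollobas_bound R s /\
  ((0 < s)%N -> bollobas_sum R t a b = bollobas_bound R s -> forall i, a i = (t + s + 1)%N).
Proof.
move=> a_gt b_ge le1; rewrite bollobas_boundE.
set c : R := 'C(2 * s + 1, s)%:R.
have c0 : 0 < c by rewrite ltr0n bin_gt0; lia.
pose w i : R := ('C(a i + b i - 2 * t, a i - t)%:R)^-1.
have w0 i : 0 < w i.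
  by rewrite invr_gt0 ltr0n bin_gt0; have := a_gt i; have := b_ge i; lia.
have gap i : c <= 'C(a i - t + s, s)%:R.
  by rewrite ler_nat leq_bin2l //; have := a_gt i; lia.
have E : \sum_i ('C(a i - t + s, s)%:R - c) * w i
    = threshold_sum R t s a b - c * bollobas_sum R t a b.
  rewrite /threshold_sum mulr_sumr -sumrB; apply: eq_bigr => i _.
  by rewrite mulrBl.
have term0 i : 0 <= ('C(a i - t + s, s)%:R - c) * w i.
  by rewrite mulr_ge0 ?subr_ge0 ?gap // ltW.
have sum0 : 0 <= \sum_i ('C(a i - t + s, s)%:R - c) * w i by apply: sumr_ge0.
have cS : c * bollobas_sum R t a b <= 1 by lra.
split; first by rewrite -[leRHS]mulr1 -ler_pdivrMl ?invr_gt0 // invrK.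
move=> s0 SE i.
have {}sum0 : \sum_i ('C(a i - t + s, s)%:R - c) * w i == 0.
  rewrite eq_le sum0 andbT E SE mulfV ?gt_eqF //; lra.
rewrite psumr_eq0 // in sum0.
have /allP/(_ i) := sum0; rewrite mem_index_enum => /(_ isT) /=.
rewrite mulf_eq0 subr_eq0 eqr_nat (gt_eqF (w0 i)) orbF => /eqP binE.
apply/eqP; rewrite eqn_leq; have := a_gt i; rewrite addn1 => ->; rewrite andbT leqNgt.
apply/negP => lta; have : ('C(2 * s + 1, s) < 'C(a i - t + s, s))%N.
  by apply: ltn_bin2l; lia.
by rewrite binE ltnn.
Qed.

Lemma bollobas_sum_const a b :
  (forall i, a i = (t + s + 1)%N) -> (forall i, b i = (t + s + 1)%N) ->
  bollobas_sum R t a b = m%:R / 'C(2 * s + 2, s + 1)%:R.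
Proof.
move=> aE bE; rewrite /bollobas_sum (eq_bigr (fun=> ('C(2 * s + 2, s + 1)%:R)^-1)).
  by rewrite sumr_const card_ord -[LHS]mulr_natl.
by move=> i _; rewrite aE bE; congr (_%:R^-1); congr 'C(_, _); lia.
Qed.

End Numerics.

(** * Bound and equality case, for sets and subspaces together *)

Section Conclusion.
Variables (R : realFieldType) (S : Type) (siz : S -> nat) (meet : S -> S -> S).
Hypothesis meetl : forall X Y, (siz (meet X Y) <= siz X)%N.
Hypothesis meetr : forall X Y, (siz (meet X Y) <= siz Y)%N.
Hypothesis meet_eq : forall X Y,
  (siz X <= siz (meet X Y))%N -> (siz Y <= siz (meet X Y))%N -> X = Y.
Variables (t s m : nat) (hm : (1 < m)%N) (A B : 'I_m -> S).
Hypothesis cross : forall i j, i != j -> (t + s < siz (meet (A i) (B j)))%N.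

Lemma ord_other (i : 'I_m) : exists j, i != j.
Proof.
have [->|i0] := eqVneq i (idx1 hm); last by exists (idx1 hm).
by exists (idx2 hm).
Qed.

Lemma cross_gt i : (t + s < siz (A i))%N && (t + s < siz (B i))%N.
Proof.
have [j ij] := ord_other i; apply/andP; split.
  exact: leq_trans (cross ij) (meetl _ _).
by rewrite eq_sym in ij; apply: leq_trans (cross ij) (meetr _ _).
Qed.

Let a i := siz (A i).
Let b i := siz (B i).

(** At equality a threshold sum fixes only its first family of sizes, so both orders are needed.
    With all sizes t + s + 1, crossing forces A_i = B_j for i <> j, and comparing m equal terms with
    the bound gives m = 2. *)
Lemma extremal_conclusion :
  threshold_sum R t s a b <= 1 -> threshold_sum R t s b a <= 1 ->
  let Sum := bollobas_sum R t a b in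
  Sum <= bollobas_bound R s /\
  ((1 <= s)%N -> (Sum = bollobas_bound R s <-> extremal_pairs siz t s hm A B)).
Proof.
move=> le1 le2 /=.
have ta i : (t <= a i)%N by have /andP[] := cross_gt i; rewrite /a; lia.
have tb i : (t <= b i)%N by have /andP[] := cross_gt i; rewrite /b; lia.
have [leS eqA] := bollobas_sum_le (fun i => (andP (cross_gt i)).1) tb le1.
have [_ eqB] := bollobas_sum_le (fun i => (andP (cross_gt i)).2) ta le2.
rewrite -bollobas_sumC in eqB; last by move=> i; rewrite ta tb.
have C0 : 'C(2 * s + 2, s + 1)%:R != 0 :> R by rewrite pnatr_eq0 -lt0n bin_gt0; lia.
split=> // s0; split=> [SE|[m2 [a1 b1 a2 b2] _]].
  have {eqA} aE := eqA s0 SE; have {eqB} bE := eqB s0 SE.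
  have sizeq i j : i != j -> A i = B j.
    move=> ij; have := cross ij; rewrite -addn1 => lt; apply: meet_eq.
      by rewrite aE.
    by rewrite bE.
  split; last by congr (_, _); [|apply: esym]; apply: sizeq.
    move: SE; rewrite (bollobas_sum_const _ aE bE) /bollobas_bound => /(divIf C0)/eqP.
    by rewrite eqr_nat => /eqP.
  by split; [apply: aE | apply: bE | apply: aE | apply: bE].
have two i : i = idx1 hm \/ i = idx2 hm.
  have := ltn_ord i; rewrite [X in (_ < X)%N]m2.
  by case: i => [[|[|i]] lti] //= _; [left | right]; apply: val_inj.
rewrite (@bollobas_sum_const _ _ s) ?m2 // => i; rewrite /a /b; case: (two i) => -> //.
Qed.

End Conclusion.

Theorem subspace_bollobas (R : realFieldType) (t s : nat) (F : fieldType) (V : vectType F)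
    (m : nat) (hm : (1 < m)%N) (A B : 'I_m -> {vspace V}) :
  cross_subspaces t s A B ->
  let S := bollobas_sum R t (fun i => \dim (A i)) (fun i => \dim (B i)) in
  S <= bollobas_bound R s /\
  ((1 <= s)%N -> (S = bollobas_bound R s <->
     extremal_pairs (fun X : {vspace V} => \dim X) t s hm A B)).
Proof.
case=> AB0 ABs.
have meetl (X Y : {vspace V}) : (\dim (X :&: Y) <= \dim X)%N by rewrite dimvS ?capvSl.
have meetr (X Y : {vspace V}) : (\dim (X :&: Y) <= \dim Y)%N by rewrite dimvS ?capvSr.
have AB_gt := cross_gt meetl meetr hm ABs.
apply: (extremal_conclusion meetl meetr _ hm ABs).
- move=> X Y leX leY; transitivity (X :&: Y)%VS; [apply/esym|]; apply/eqP.
    by rewrite eqEdim capvSl.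
  by rewrite eqEdim capvSr.
- exact: threshold_bollobas.
- apply: threshold_bollobas; split=> [i|i j ij|i]; rewrite 1?capvC //.
    by apply: ABs; rewrite eq_sym.
  by rewrite andbC.
Qed.

Lemma free_tuple_exists (F : fieldType) n :
  exists (V : vectType F) (X : n.-tuple V), free X.
Proof.
have sz : size (vbasis {: 'rV[F]_n}) == n
  by rewrite size_tuple dimvf dim_matrix; apply/eqP; rewrite mul1r.
by exists 'rV[F]_n, (Tuple sz); apply: basis_free (vbasisP _).
Qed.

Lemma fset_as_subspaces (F : fieldType) (K : choiceType) (U : {fset K}) :
  exists (V : vectType F) (sp : {fset K} -> {vspace V}),
    (forall X : {fset K}, (X `<=` U)%fset -> \dim (sp X) = #|` X|) /\
    (forall X Y : {fset K}, (X `<=` U)%fset -> (Y `<=` U)%fset ->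
       \dim (sp X :&: sp Y) = #|` (X `&` Y)%fset|).
Proof.
have [V [X Xfree]] := free_tuple_exists F #|{: U}|.
exists V, (fun Y => spanI X (enum_rank @: fsub U Y)); split=> [Y sY | Y Z sY sZ].
  by rewrite dim_spanI // card_imset ?card_fsub //; apply: enum_rank_inj.
rewrite dim_spanI_cap // -imsetI; last by move=> ? ? _ _; apply: enum_rank_inj.
rewrite card_imset; last exact: enum_rank_inj.
by rewrite -fsubI card_fsub // (fsubset_trans (fsubsetIl _ _)).
Qed.

Theorem set_bollobas (R : realFieldType) (t s : nat) (K : choiceType)
    (m : nat) (hm : (1 < m)%N) (A B : 'I_m -> {fset K}) :
  cross_sets t s A B ->
  let S := bollobas_sum R t (fun i => #|` A i|) (fun i => #|` B i|) in
  S <= bollobas_bound R s /\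
  ((1 <= s)%N -> (S = bollobas_bound R s <->
     extremal_pairs (fun X : {fset K} => #|` X|) t s hm A B)).
Proof.
case=> AB0 ABs.
have meetl (X Y : {fset K}) : (#|` (X `&` Y)%fset| <= #|` X|)%N.
  exact/fsubset_leq_card/fsubsetIl.
have meetr (X Y : {fset K}) : (#|` (X `&` Y)%fset| <= #|` Y|)%N.
  exact/fsubset_leq_card/fsubsetIr.
have AB_gt := cross_gt meetl meetr hm ABs.
pose U : {fset K} := (\bigcup_(i <- enum 'I_m) (A i `|` B i))%fset.
have sA i : (A i `<=` U)%fset.
  apply: fsubset_trans (fsubsetUl _ (B i)) _.
  by apply: (@bigfcup_sup _ _ _ i xpredT (fun i => A i `|` B i)%fset); rewrite ?mem_enum.
have sB i : (B i `<=` U)%fset.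
  apply: fsubset_trans (fsubsetUr (A i) _) _.
  by apply: (@bigfcup_sup _ _ _ i xpredT (fun i => A i `|` B i)%fset); rewrite ?mem_enum.
have [V [sp [dsp dspI]]] := fset_as_subspaces rat U.
have le1 (A' B' : 'I_m -> {fset K}) :
    (forall i, (A' i `<=` U)%fset) -> (forall i, (B' i `<=` U)%fset) ->
    (forall i, #|` (A' i `&` B' i)%fset| <= t)%N ->
    (forall i j, i != j -> #|` (A' i `&` B' j)%fset| > t + s)%N ->
    (forall i, (t + s < #|` A' i|)%N && (t + s < #|` B' i|)%N) ->
  threshold_sum R t s (fun i => #|` A' i|) (fun i => #|` B' i|) <= 1.
  move=> sA' sB' AB0' ABs' ABd'.
  have := @threshold_bollobas R _ V t s _ (fun i => sp (A' i)) (fun i => sp (B' i)).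
  rewrite /threshold_sum; under eq_bigr => i _ do rewrite !dsp //.
  by apply; split=> [i|i j ij|i]; rewrite ?dspI ?dsp //; apply: ABs'.
apply: (extremal_conclusion meetl meetr _ hm ABs).
- move=> X Y leX leY; transitivity (X `&` Y)%fset; [apply/esym|]; apply/eqP.
    by rewrite eqEfcard fsubsetIl.
  by rewrite eqEfcard fsubsetIr.
- exact: le1.
- apply: le1 => // [i|i j ij|i]; rewrite 1?fsetIC //.
    by apply: ABs; rewrite eq_sym.
  by rewrite andbC.
Qed.

(** * Sharpness of the constant *)

Lemma two_pairs_sum (R : realFieldType) t s (S : Type) (siz : S -> nat) (P Q : S) :
  siz P = (t + s + 1)%N -> siz Q = (t + s + 1)%N ->
  bollobas_sum R t (fun i : 'I_2 => siz (if i == ord0 then P else Q))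
                   (fun i : 'I_2 => siz (if i == ord0 then Q else P)) = bollobas_bound R s.
Proof. by move=> sP sQ; apply: bollobas_sum_const => i; case: ifP. Qed.

(** The extremal system (P, Q), (Q, P): trivial meets within each pair, equal members across
    pairs. *)
Lemma two_pairs_cross (S : Type) (siz : S -> nat) (meet : S -> S -> S) (P Q : S) t s
    (A := fun i : 'I_2 => if i == ord0 then P else Q)
    (B := fun i : 'I_2 => if i == ord0 then Q else P) :
  (forall X, meet X X = X) -> siz P = (t + s + 1)%N -> siz Q = (t + s + 1)%N ->
  siz (meet P Q) = 0%N -> siz (meet Q P) = 0%N ->
  (forall i, siz (meet (A i) (B i)) <= t)%N /\
  (forall i j, i != j -> siz (meet (A i) (B j)) > t + s)%N.
Proof.
move=> meetXX sP sQ PQ QP; split=> [i|i j]; rewrite /A /B; first by case: ifP; rewrite ?PQ ?QP.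
have two (k : 'I_2) : k != ord0 -> k = ord_max by case: k => [[|[|k]] ltk] // _; apply: val_inj.
have [i0|/two i1] := eqVneq i ord0; have [j0|/two j1] := eqVneq j ord0;
  rewrite ?i0 ?i1 ?j0 ?j1 ?eqxx //= meetXX.
  by rewrite sP addn1.
by rewrite sQ addn1.
Qed.

Lemma disjoint_fsets n : exists P Q : {fset nat},
  [/\ #|` P| = n, #|` Q| = n & (P `&` Q)%fset = fset0].
Proof.
exists [fset x in iota 0 n]%fset, [fset x in iota n n]%fset.
rewrite !card_fseq !undup_id ?iota_uniq // !size_iota; split=> //.
apply/fsetP => x; rewrite !inE !mem_iota; lia.
Qed.

Lemma disjoint_subspaces (F : fieldType) n : exists (V : vectType F) (P Q : {vspace V}),
  [/\ \dim P = n, \dim Q = n & (P :&: Q)%VS = 0%VS].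
Proof.
have [V [X Xfree]] := free_tuple_exists F (n + n).
exists V, (spanI X [set i : 'I_(n + n) | i < n]%N), (spanI X [set i : 'I_(n + n) | n <= i]%N).
have c1 : #|[set i : 'I_(n + n) | i < n]%N| = n.
  rewrite (_ : [set i | _] = lshift n @: [set: 'I_n]).
    by rewrite card_imset ?cardsT ?card_ord //; apply: lshift_inj.
  apply/setP => i; rewrite inE; apply/idP/imsetP => [lt|[j _ ->]] /=; last exact: ltn_ord.
  by exists (Ordinal lt); [rewrite inE | apply: val_inj].
have c2 : [set i : 'I_(n + n) | n <= i]%N = ~: [set i : 'I_(n + n) | i < n]%N.
  by apply/setP => i; rewrite !inE leqNgt.
rewrite !dim_spanI // c1 c2; split=> //.
  by apply/eqP; rewrite -(eqn_add2l n) -{1}c1 cardsC card_ord.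
by apply/eqP; rewrite -dimv_eq0 dim_spanI_cap // setICr cards0.
Qed.

Theorem corollary5p1 (R : realFieldType) (t s : nat) :
  [/\ (forall (K : choiceType) (m : nat) (hm : (1 < m)%N)
              (A B : 'I_m -> {fset K}),
         cross_sets t s A B ->
         let S := bollobas_sum R t (fun i => #|` A i|) (fun i => #|` B i|) in
         S <= bollobas_bound R s /\
         ((1 <= s)%N ->
          (S = bollobas_bound R s <->
           extremal_pairs (fun X : {fset K} => #|` X|) t s hm A B))),
      (forall (F : fieldType) (V : vectType F) (m : nat) (hm : (1 < m)%N)
              (A B : 'I_m -> {vspace V}),
         cross_subspaces t s A B ->
         let S := bollobas_sum R t (fun i => \dim (A i)) (fun i => \dim (B i)) in
         S <= bollobas_bound R s /\
         ((1 <= s)%N ->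
          (S = bollobas_bound R s <->
           extremal_pairs (fun X : {vspace V} => \dim X) t s hm A B))),
      (forall c : R, c < bollobas_bound R s ->
         ~ (forall (K : choiceType) (m : nat) (A B : 'I_m -> {fset K}),
              (1 < m)%N -> cross_sets t s A B ->
              bollobas_sum R t (fun i => #|` A i|) (fun i => #|` B i|) <= c)) &
      (forall (F : fieldType) (c : R), c < bollobas_bound R s ->
         ~ (forall (V : vectType F) (m : nat) (A B : 'I_m -> {vspace V}),
              (1 < m)%N -> cross_subspaces t s A B ->
              bollobas_sum R t (fun i => \dim (A i)) (fun i => \dim (B i)) <= c))].
Proof.
split.
- by move=> K m hm A B; apply: set_bollobas.
- by move=> F V m hm A B; apply: subspace_bollobas.
- move=> c ltc le_c; have [P [Q [cP cQ PQ]]] := disjoint_fsets (t + s + 1).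
  have := le_c _ _ (fun i : 'I_2 => if i == ord0 then P else Q)
    (fun i => if i == ord0 then Q else P) isT.
  rewrite (@two_pairs_sum R t s _ (fun X : {fset nat} => #|` X|) P Q) // leNgt ltc.
  suff cross : cross_sets t s (fun i : 'I_2 => if i == ord0 then P else Q)
    (fun i => if i == ord0 then Q else P) by move/(_ cross).
  apply: (@two_pairs_cross _ (fun X : {fset nat} => #|` X|) (fun X Y => X `&` Y)%fset) => //.
  - exact: fsetIid.
  - by rewrite PQ cardfs0.
  - by rewrite fsetIC PQ cardfs0.
- move=> F c ltc le_c; have [V [P [Q [dP dQ PQ]]]] := disjoint_subspaces F (t + s + 1).
  have := le_c V _ (fun i : 'I_2 => if i == ord0 then P else Q)
    (fun i => if i == ord0 then Q else P) isT.
  rewrite (@two_pairs_sum R t s _ (fun X : {vspace V} => \dim X) P Q) // leNgt ltc.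
  suff cross : cross_subspaces t s (fun i : 'I_2 => if i == ord0 then P else Q)
    (fun i => if i == ord0 then Q else P) by move/(_ cross).
  apply: (@two_pairs_cross _ (fun X : {vspace V} => \dim X) (fun X Y => X :&: Y)%VS) => //.
  - exact: capvv.
  - by rewrite PQ dimv0.
  - by rewrite capvC PQ dimv0.
Qed.
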